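(* Let $r,k\in\mathbb Z$, $0\le k\le r$, and suppose that $U\in Y_r$ solves $Q^r_k\text{-}\mathbf{VTD}^r_k$. For every $n=1,\dots,N$ set $$\widetilde U|_{I_n}=U|_{I_n}+a_n\vartheta_n,\qquad \vartheta_n\in P_{r+1}(I_n,\mathbb R),$$ where $\vartheta_n$ vanishes in all $r+1$ quadrature points of $Q^r_k$ (counted with multiplicity) and additionally satisfies $\vartheta_n^{(\lfloor k/2\rfloor+1)}(t_n^-)=1$, while the vector $a_n\in\mathbb R^d$ is defined by $$a_n=M^{-1}\left(\frac{\mathrm d^{\lfloor k/2\rfloor}}{\mathrm dt^{\lfloor k/2\rfloor}}F\big(t,U(t)\big)\Big|_{t=t_n^-}-M\,U^{(\lfloor k/2\rfloor+1)}(t_n^-)\right).$$ Moreover, let $\widetilde U(t_0^-)=U(t_0^-)$. Then $\widetilde U\in Y_{r+1}$ solves $Q^r_k\text{-}\mathbf{VTD}^{r+1}_{k+2}$.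
   Context: Problem: $M u'(t)=F(t,u(t))$, $u(t_0)=u_0\in\mathbb R^d$, on $I=(t_0,t_0+T]$, $T>0$, with $M\in\mathbb R^{d\times d}$ regular; $F$ is sufficiently smooth (all derivatives of $F$ that occur exist and are continuous) and Lipschitz continuous in its second variable. Notation: mesh $t_0<t_1<\dots<t_N=t_0+T$, $I_n=(t_{n-1},t_n]$, $\tau_n=t_n-t_{n-1}$. $(\cdot,\cdot)$ is the Euclidean inner product on $\mathbb R^d$. $P_s(J,\mathbb R^q)$ is the space of $\mathbb R^q$-valued polynomials on $J$ of degree $\le s$, and $P_{-1}=\{0\}$. $Y_s$ is the space of functions $\varphi\in L^2(I,\mathbb R^d)$ with $\varphi|_{I_n}\in P_s(I_n,\mathbb R^d)$ for all $n=1,\dots,N$. $v(t_n^\pm)$ are one-sided limits, $[v]_n=v(t_n^+)-v(t_n^-)$; derivatives at $t_n^-$ and $t_{n-1}^+$ are one-sided ones taken from $I_n$ when the local problem on $I_n$ is considered. $\delta_{i,j}$ is the Kronecker delta. Note $\lfloor (k-1)/2\rfloor=-1$ for $k=0$. Quadrature: for $0\le k\le r$ let $\widehat{\mathcal I}^r_k:C^{\lfloor k/2\rfloor}([-1,1])\to P_r([-1,1])$ be the Hermite interpolation operator preserving derivatives of orders $0,\dots,\lfloor\frac{k-1}{2}\rfloor$ at $-1$ (none if $k=0$), derivatives of orders $0,\dots,\lfloor\frac k2\rfloor$ at $+1$, and the function values at the zeros $\hat t_1,\dots,\hat t_{r-k}\in(-1,1)$ of the $(r-k)$th Jacobi polynomial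 with respect to the weight $(1+\hat t)^{\lfloor\frac{k-1}{2}\rfloor+1}(1-\hat t)^{\lfloor\frac k2\rfloor+1}$. Let $\widehat Q^r_k[\hat f]=\int_{-1}^1\widehat{\mathcal I}^r_k\hat f\,\mathrm d\hat t$. $\mathcal I^r_k$ and $Q^r_k$ denote their affine transformations to $I_n$ (so $Q^r_k[\varphi]=\int_{I_n}\mathcal I^r_k\varphi\,\mathrm dt$), and $t_{n,i}=\frac12(t_{n-1}+t_n+\tau_n\hat t_i)$. The $r+1$ quadrature points of $Q^r_k$ on $I_n$, counted with multiplicity, are $t_{n-1}$ with multiplicity $\lfloor\frac{k-1}{2}\rfloor+1$, $t_n$ with multiplicity $\lfloor\frac k2\rfloor+1$, and $t_{n,1},\dots,t_{n,r-k}$ each simple; ''vanishing in all quadrature points'' means having zeros of (at least) these multiplicities. Method: for a quadrature rule $Q$ on $I_n$ and integers $s\ge0$, $0\le m\le s+1$, a function $V\in Y_s$ with $V(t_0^-)=u_0$ solves $Q\text{-}\mathbf{VTD}^s_m$ if for every $n=1,\dots,N$: (1) if $m\ge1$: $V(t_{n-1}^+)=V(t_{n-1}^-)$; (2) if $m\ge2$: $M V^{(i+1)}(t_n^-)=\frac{\mathrm d^i}{\mathrm dt^i}\big(F(t,V(t))\big)\big|_{t=t_n^-}$ for $i=0,\dots,\lfloor\frac m2\rfloor-1$; (3) if $m\ge3$: $M V^{(i+1)}(t_{n-1}^+)=\frac{\mathrm d^i}{\mathrm dt^i}\big(F(t,V(t))\big)\big|_{t=t_{n-1}^+}$ for $i=0,\dots,\lfloor\frac{m-1}2\rfloor-1$;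 (4) $Q\big[(MV',\varphi)\big]+\delta_{0,m}\big(M[V]_{n-1},\varphi(t_{n-1}^+)\big)=Q\big[(F(\cdot,V(\cdot)),\varphi)\big]$ for all $\varphi\in P_{s-m}(I_n,\mathbb R^d)$ (no condition if $m=s+1$). *)

(* Defs.v *)
From HB Require Import structures.
From mathcomp Require Import all_boot all_order all_algebra.
From mathcomp Require Import all_classical all_reals all_analysis.

Set Implicit Arguments.
Unset Strict Implicit.
Unset Printing Implicit Defensive.

Import Order.TTheory GRing.Theory Num.Theory.
Import numFieldNormedType.Exports.

Local Open Scope classical_set_scope.
Local Open Scope ring_scope.

Section OneSided.
Context {R : realType} {V : normedModType R}.

(* g(x^-) and g(x^+).  The one-sided derivatives g^(i)(x^-), g^(i)(x^+) are
   written left_lim (derive1n i g) x and right_lim (derive1n i g) x: these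
   limits only involve g strictly on one side of x, where the two-sided
   derivative coincides with the derivative of the restriction of g. *)
Definition left_lim (g : R -> V) (x : R) : V := lim (g y @[y --> x^'-]).
Definition right_lim (g : R -> V) (x : R) : V := lim (g y @[y --> x^'+]).

End OneSided.

Section Smoothness.
Context {R : realType} {d : nat}.
Implicit Type G : R * 'cV[R]_d -> 'cV[R]_d.

(* G' is the partial derivative of G in direction v at every point of A, with
   increments restricted to A (hence one-sided on the boundary of A). *)
Definition is_partial (A : set (R * 'cV[R]_d)) (v : R * 'cV[R]_d) G G' :=
  forall z, A z ->
    (h^-1 *: (G (z + h *: v) - G z))
      @[h --> within [set h | A (z + h *: v)] 0^'] --> G' z.

Definition coord_dir (v : R * 'cV[R]_d) : Prop :=
  v = (1, 0) \/ exists j : 'I_d, v = (0, delta_mx j ord0).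

(* All partial derivatives of G of order at most q exist and are continuous
   on A. *)
Fixpoint Cq_on (A : set (R * 'cV[R]_d)) (q : nat) G : Prop :=
  {within A, continuous G} /\
  if q is q'.+1 then
    forall v, coord_dir v -> exists2 G', is_partial A v G G' & Cq_on A q' G'
  else True.

End Smoothness.

Section Polynomials.
Context {R : realType} {d : nat}.

Definition dot (x y : 'cV[R]_d) : R := \sum_(i < d) x i ord0 * y i ord0.

Definition horner_cv (p : 'cV[{poly R}]_d) (x : R) : 'cV[R]_d :=
  map_mx (fun q : {poly R} => q.[x]) p.

(* Membership in P_s (R^d-valued) is size_le s.+1 p; in particular size_le 0 p
   describes P_{-1} = {0}. *)
Definition size_le (s : nat) (p : 'cV[{poly R}]_d) : Prop :=
  forall i, (size (p i ord0) <= s)%N.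

End Polynomials.

(* For k : nat, floor((k-1)/2) + 1 = uphalf k, which is 0 for k = 0, and
   floor(k/2) + 1 = k./2.+1. *)
Section Quadrature.
Context {R : realType}.

(* J is an m-th Jacobi polynomial for the weight (1+x)^a (1-x)^b; it is unique
   up to a nonzero factor. *)
Definition is_jacobi (a b m : nat) (J : {poly R}) : Prop :=
  size J = m.+1 /\
  forall q : {poly R}, (size q <= m)%N ->
    \int[@lebesgue_measure R]_(x in `[-1, 1])
      ((1 + x) ^+ a * (1 - x) ^+ b * J.[x] * q.[x]) = 0.

Definition is_jacobi_nodes (r k : nat) (nodes : seq R) : Prop :=
  [/\ uniq nodes,
      size nodes = (r - k)%N,
      (forall x, x \in nodes -> -1 < x < 1) &
      exists2 J : {poly R}, is_jacobi (uphalf k) k./2.+1 (r - k) J &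
        forall x, x \in nodes -> root J x].

Definition is_hermite (r k : nat) (nodes : seq R) (f : R -> R) (p : {poly R}) :
    Prop :=
  [/\ (size p <= r.+1)%N,
      (forall i, (i < uphalf k)%N ->
         (derivn i p).[-1] = right_lim (derive1n i f) (-1)),
      (forall i, (i <= k./2)%N ->
         (derivn i p).[1] = left_lim (derive1n i f) 1) &
      forall x, x \in nodes -> p.[x] = f x].

Definition hermite (r k : nat) (nodes : seq R) (f : R -> R) : {poly R} :=
  xget 0 [set p | is_hermite r k nodes f p].

Definition from_ref (a b x : R) : R := (a + b + (b - a) * x) / 2.

(* The inverse t |-> (2 t - (a + b)) / (b - a) of from_ref a b. *)
Definition to_ref (a b : R) : {poly R} :=
  (b - a)^-1 *: (2 *: 'X - (a + b)%:P).

Definition hermite_on (r k : nat) (nodes : seq R) (a b : R) (f : R -> R) :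
    {poly R} :=
  hermite r k nodes (f \o from_ref a b) \Po to_ref a b.

Definition quad (r k : nat) (nodes : seq R) (a b : R) (f : R -> R) : R :=
  \int[@lebesgue_measure R]_(x in `]a, b]) (hermite_on r k nodes a b f).[x].

Definition vanishes_at_quad_points (r k : nat) (nodes : seq R) (a b : R)
    (p : {poly R}) : Prop :=
  [/\ ('X - a%:P) ^+ uphalf k %| p,
      ('X - b%:P) ^+ k./2.+1 %| p &
      forall x, x \in nodes -> ('X - (from_ref a b x)%:P) %| p].

End Quadrature.

Section VTD.
Context {R : realType} {d : nat}.

(* Subintervals are indexed from 0: the n-th one is `]t n, t n.+1], n < N. *)
Definition mesh (t0 T : R) (N : nat) (t : nat -> R) : Prop :=
  [/\ t 0%N = t0, t N = t0 + T & forall n, (n < N)%N -> t n < t n.+1].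

Definition in_Y (N : nat) (t : nat -> R) (s : nat) (V : R -> 'cV[R]_d) : Prop :=
  forall n, (n < N)%N -> exists2 p : 'cV[{poly R}]_d, size_le s.+1 p &
    forall x, t n < x <= t n.+1 -> V x = horner_cv p x.

(* V is a function on the whole line; to the left of t0 only V(t0^-) matters.
   At a mesh point derive1 V need not be the one-sided derivative; a rule Q is
   meant to use its argument there only through one-sided limits, as quad
   does. *)
Record solves_VTD (M : 'M[R]_d) (F : R -> 'cV[R]_d -> 'cV[R]_d)
    (u0 : 'cV[R]_d) (N : nat) (t : nat -> R) (Q : R -> R -> (R -> R) -> R)
    (s m : nat) (V : R -> 'cV[R]_d) : Prop := SolvesVTD {
  VTD_order : (m <= s.+1)%N;
  VTD_space : in_Y N t s V;
  VTD_init : V x @[x --> (t 0%N)^'-] --> u0;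
  VTD_cont : forall n, (n < N)%N -> (1 <= m)%N ->
    right_lim V (t n) = left_lim V (t n);
  VTD_right_end : forall n i, (n < N)%N -> (2 <= m)%N -> (i < m./2)%N ->
    M *m left_lim (derive1n i.+1 V) (t n.+1)
    = left_lim (derive1n i (fun x => F x (V x))) (t n.+1);
  VTD_left_end : forall n i, (n < N)%N -> (3 <= m)%N -> (i < m.-1./2)%N ->
    M *m right_lim (derive1n i.+1 V) (t n)
    = right_lim (derive1n i (fun x => F x (V x))) (t n);
  VTD_var : forall n, (n < N)%N ->
    forall phi : 'cV[{poly R}]_d, size_le (s.+1 - m) phi ->
    Q (t n) (t n.+1) (fun x => dot (M *m derive1 V x) (horner_cv phi x))
    + (m == 0%N)%:R
      * dot (M *m (right_lim V (t n) - left_lim V (t n))) (horner_cv phi (t n))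
    = Q (t n) (t n.+1) (fun x => dot (F x (V x)) (horner_cv phi x))
}.

End VTD.

(* Main.v *)
Require Import Defs.
From mathcomp Require Import all_boot all_order all_algebra.
From mathcomp Require Import all_classical all_reals all_analysis.
From mathcomp Require Import ring lra zify.

(** On one interval ]a, b] the method sees F(., U) only through finitely many
    data: the one-sided derivatives of order less than k./2.+1 at b and less than
    uphalf k at a, and the values at the inner nodes. Since theta vanishes at
    all these points with multiplicity, F(., U) and F(., Ut) have the same data
    ([jet_along_curves], [common_interpolant]). Replacing both by a polynomial G
    with these data reduces the theorem to polynomial algebra: with
    W = ('X - a) ^+ uphalf k * ('X - b) ^+ k./2.+1 * L, where L is the polynomial
    of the inner nodes, the rule integrates the remainder modulo W
    ([quad_interpolates]), and it is exact up to degree 2 r - k because, pulled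
    back to the reference interval, L is a multiple of a Jacobi polynomial
    ([quad_poly_int0], [quad_exact]).

    Let e = M Ut' - G. The new method asks that e vanish at b to order
    k./2.+1 and at a to order uphalf k, that Ut be continuous at a, and that the
    quadrature of e * phi be 0 for the admissible phi.

    - At b: the vector a_n is defined so that the one new condition holds, and
      the old ones persist because theta' vanishes there to order k./2 ([step_right]).
    - Variational equation: by exactness, passing from U' to Ut' adds the exact
      integral of theta' * phi times M a_n. Integration by parts and orthogonality
      turn the integral into - theta(a) phi(a) ([poly_int_theta]).
    - At a: take phi = L. For k = 0 the product e * L is then 0 modulo W, and the
      equation says that the boundary term cancels the jump of U: Ut is
      continuous ([step_jump]). For 0 < k there is no boundary term, and e * L
      can differ from 0 modulo W only by a multiple of
      ('X - a) ^+ (uphalf k).-1 * ('X - b) ^+ k./2.+1 * L. The equation says that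
      the integral of this multiple is 0, whereas the integral of the polynomial
      itself is not ([left_weight_neq0]); so the multiple is 0, which is the
      condition of highest order at a ([step_left]).

    In both cases the boundary term is cancelled, which leaves the variational
    equation of the new method ([step_var]). *)

Set Implicit Arguments.
Unset Strict Implicit.
Unset Printing Implicit Defensive.

Import Order.TTheory GRing.Theory Num.Theory.
Import numFieldNormedType.Exports.

Local Open Scope classical_set_scope.
Local Open Scope ring_scope.

(** * Polynomials: multiplicity of roots and integration *)

Section PolynomialCalculus.
Context {R : realType}.
Implicit Types (p q : {poly R}) (a b c : R).

Lemma deriv_XsubC_exp m c : (('X - c%:P) ^+ m.+1)^`() = ('X - c%:P) ^+ m *+ m.+1.
Proof. by rewrite deriv_exp derivXsubC mul1r. Qed.

Lemma dvdp_XsubC_exp_deriv m c p :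
  ('X - c%:P) ^+ m.+1 %| p -> ('X - c%:P) ^+ m %| p^`().
Proof.
move=> /dvdpP[q ->]; rewrite derivM deriv_XsubC_exp dvdp_add//.
  by rewrite exprS mulrA dvdp_mull.
by rewrite mulrnAr -mulrnAl dvdp_mull.
Qed.

(** The step that makes divisibility by a power of 'X - c readable from
    derivatives; it uses characteristic zero, which keeps the factor m.+1 that
    the derivative produces invertible. *)
Lemma dvdp_XsubC_expS m c p :
  root p c -> ('X - c%:P) ^+ m %| p^`() -> ('X - c%:P) ^+ m.+1 %| p.
Proof.
move=> pc; elim: m => [|m IHm] dvd'; first by rewrite expr1 dvdp_XsubCl.
have /dvdpP[q pE] : ('X - c%:P) ^+ m.+1 %| p.
  by apply: IHm; apply: dvdp_trans dvd'; rewrite exprS dvdp_mull.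
have := dvd'; rewrite pE derivM deriv_XsubC_exp dvdp_addr; last exact: dvdp_mull.
rewrite exprS -mulr_natr mulrA mulrAC dvdp_mul2r ?expf_neq0 ?polyXsubC_eq0//.
rewrite -polyC_natr mulrC mul_polyC dvdpZr ?pnatr_eq0// => /dvdpP[s ->].
by rewrite -!mulrA -!exprS dvdp_mull.
Qed.

Lemma dvdp_XsubC_expP m c p :
  (forall i, (i < m)%N -> p^`(i).[c] = 0) <-> ('X - c%:P) ^+ m %| p.
Proof.
elim: m p => [|m IHm] p; first by rewrite expr0 dvd1p.
split=> [p0|dvd].
  apply: dvdp_XsubC_expS; first by apply/eqP; exact: (p0 0%N).
  by apply/IHm => i im; rewrite -derivSn; apply: p0.
case=> [_|i im].
  rewrite derivn0; apply/eqP; rewrite -/(root p c) -dvdp_XsubCl.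
  by apply: dvdp_trans dvd; rewrite exprS dvdp_mulr.
by rewrite derivSn (IHm _).2//; exact: dvdp_XsubC_exp_deriv.
Qed.

Lemma poly_antiderivative p : exists q, q^`() = p.
Proof.
exists (\poly_(i < (size p).+1) (p`_i.-1 / i%:R)); apply/polyP => i.
rewrite coef_deriv coef_poly ltnS; case: ltnP => [_|pi].
  by rewrite /= -(mulr_natr (_ / _)) divfK ?pnatr_eq0.
by rewrite mul0rn nth_default.
Qed.

(** Every polynomial has a polynomial antiderivative, so after
    [poly_int_deriv] all integrals below are computed algebraically. *)
Definition poly_int a b p := \int[@lebesgue_measure R]_(x in `[a, b]) p.[x].

Lemma poly_int_deriv a b p : a < b -> poly_int a b p^`() = p.[b] - p.[a].
Proof.
move=> ab; rewrite /poly_int /Rintegral (@continuous_FTC2 _ _ (horner p)) //=.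
- by apply: continuous_subspaceT; exact: continuous_horner.
- split; first by move=> x _; exact: derivable_horner.
  + by apply: cvg_at_right_filter; exact: continuous_horner.
  + by apply: cvg_at_left_filter; exact: continuous_horner.
- by move=> x _; rewrite derivE.
Qed.

Lemma poly_int_obnd a b p : a < b ->
  \int[@lebesgue_measure R]_(x in `]a, b]) p.[x] = poly_int a b p.
Proof.
move=> ab; rewrite Rintegral_itv_obnd_cbnd//.
have pI : lebesgue_measure.-integrable `[a, b] (EFin \o horner p).
  apply: continuous_compact_integrable; first exact: segment_compact.
  by apply: continuous_subspaceT; exact: continuous_horner.
apply: integrableS pI => //.
by apply: subset_itvr; rewrite bnd_simp.
Qed.

Lemma poly_intD a b p q : a < b ->
  poly_int a b (p + q) = poly_int a b p + poly_int a b q.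
Proof.
move=> ab; have [P <-] := poly_antiderivative p.
have [Q <-] := poly_antiderivative q.
by rewrite -derivD !poly_int_deriv// !hornerD opprD addrACA.
Qed.

Lemma poly_intZ a b c p : a < b -> poly_int a b (c *: p) = c * poly_int a b p.
Proof.
move=> ab; have [P <-] := poly_antiderivative p.
by rewrite -derivZ !poly_int_deriv// !hornerZ -mulrBr.
Qed.

Lemma poly_intB a b p q : a < b ->
  poly_int a b (p - q) = poly_int a b p - poly_int a b q.
Proof. by move=> ab; rewrite -scaleN1r poly_intD// poly_intZ// mulN1r. Qed.

Lemma poly_int_by_parts a b p q : a < b ->
  poly_int a b (p^`() * q) = p.[b] * q.[b] - p.[a] * q.[a] - poly_int a b (p * q^`()).
Proof.
move=> ab; rewrite -!hornerM -poly_int_deriv// -poly_intB// derivM.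
by rewrite addrK.
Qed.

(** If the integral were not positive, the antiderivative, which is
    nondecreasing on [a, b], would be constant there; having infinitely many
    equal values it would be a constant polynomial. *)
Lemma poly_int_gt0 a b p : a < b -> p != 0 ->
  (forall x, a <= x <= b -> 0 <= p.[x]) -> 0 < poly_int a b p.
Proof.
move=> ab p0 pge0; have [P PE] := poly_antiderivative p.
have mono x y : a <= x -> x <= y -> y <= b -> P.[x] <= P.[y].
  move=> ax xy yb; rewrite -subr_ge0.
  have [||c cI ->] := @MVT_segment _ (horner P) (horner p) _ _ xy.
  - by move=> z _; rewrite -PE; exact: is_derive_poly.
  - by apply: continuous_subspaceT; exact: continuous_horner.
  rewrite mulr_ge0 ?subr_ge0// pge0//; move: cI; rewrite in_itv/= => /andP[xc cy].
  by rewrite (le_trans ax xc) (le_trans cy yb).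
have Pconst : P.[b] - P.[a] <= 0 -> forall x, a <= x <= b -> P.[x] = P.[a].
  rewrite subr_le0 => Pba x /andP[ax xb]; apply/eqP.
  rewrite eq_le (mono a x) ?lexx// andbT.
  exact: le_trans (mono _ _ ax xb (lexx b)) Pba.
rewrite -PE poly_int_deriv// ltNge; apply/negP => /Pconst {}Pconst.
suff P0 : P = (P.[a])%:P by move: p0; rewrite -PE P0 derivC eqxx.
apply/eqP; rewrite -subr_eq0; apply/eqP.
(* Any infinite family of points of [a, b] would do. *)
pose rs := mkseq (fun i => a + (b - a) / i.+1%:R) (size (P - (P.[a])%:P)).
apply: (@roots_geq_poly_eq0 _ _ rs).
- apply/allP => _ /mapP[i _ ->]; rewrite /root !hornerE Pconst ?subrr//.
  have ba : 0 <= b - a by rewrite subr_ge0 ltW.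
  rewrite lerDl divr_ge0//= -lerBrDl ler_pdivrMr ?ltr0Sn// ler_peMr//.
  by rewrite ler1n.
- rewrite mkseq_uniq// => i j /addrI /mulfI h.
  have /h /invr_inj /eqP : b - a != 0 by rewrite subr_eq0 gt_eqF.
  by rewrite eqr_nat => /eqP[].
- by rewrite size_mkseq.
Qed.

End PolynomialCalculus.

(** * Jets of functions at the endpoints of an interval *)

Section Jets.
Context {R : realType}.

(** The two endpoints of an interval are treated at once: Phi is the filter of
    one-sided neighbourhoods of the endpoint c that live inside ]a, b[. *)
Record one_sided (a b c : R) (Phi : set_system R) : Prop := OneSided {
  one_sided_proper : ProperFilter Phi;
  one_sided_itv : \forall x \near Phi, a < x < b;
  one_sided_cvg : Phi --> c }.

Lemma one_sided_right (a b : R) : a < b -> one_sided a b a a^'+.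
Proof.
move=> ab; split; first exact: at_right_proper_filter.
- near=> x; apply/andP; split; near: x; [exact: nbhs_right_gt|exact: nbhs_right_lt].
- by apply: cvg_at_right_filter; exact: cvg_id.
Unshelve. all: by end_near. Qed.

Lemma one_sided_left (a b : R) : a < b -> one_sided a b b b^'-.
Proof.
move=> ab; split; first exact: at_left_proper_filter.
- near=> x; apply/andP; split; near: x; [exact: nbhs_left_gt|exact: nbhs_left_lt].
- by apply: cvg_at_left_filter; exact: cvg_id.
Unshelve. all: by end_near. Qed.

(** The derivatives of f of order at most m exist on ]a, b[ and tend, at the
    endpoint c, to those of the polynomial p. Only p modulo the power
    ('X - c) ^+ m.+1 matters, see [jet_congr]; carrying a polynomial instead of
    a list of limits turns Leibniz and chain rules into ring operations. *)
Fixpoint jet (a b c : R) (Phi : set_system R) (m : nat) (f : R -> R)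
    (p : {poly R}) : Prop :=
  f @ Phi --> p.[c] /\
  if m is m'.+1 then
    exists2 f' : R -> R, (forall x, a < x < b -> is_derive x 1 f (f' x)) &
      jet a b c Phi m' f' p^`()
  else True.

Lemma near_itv (a b x : R) : a < x < b -> \forall y \near x, a < y < b.
Proof.
move=> /andP[ax xb]; near=> y; apply/andP; split; near: y;
  [exact: lt_nbhsr|exact: lt_nbhsl].
Unshelve. all: by end_near. Qed.

Section JetTheory.
Context {a b c : R} {Phi : set_system R} (Phic : one_sided a b c Phi).
Let PhiP : ProperFilter Phi := one_sided_proper Phic.
#[local] Existing Instance PhiP.
Local Notation jet := (jet a b c Phi).

Lemma jet_cvg m f p : jet m f p -> f @ Phi --> p.[c].
Proof. by case: m => [|m] []. Qed.

Lemma jetW m f p : jet m.+1 f p -> jet m f p.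
Proof.
elim: m f p => [|m IHm] f p [fp [f' f'E f'p]]; split=> //.
by exists f' => //; exact: IHm.
Qed.

Lemma jet_poly m p : jet m (horner p) p.
Proof.
elim: m p => [|m IHm] p; split=> //.
- exact: (cvg_comp _ _ (one_sided_cvg Phic) (@continuous_horner _ p c)).
- exact: (cvg_comp _ _ (one_sided_cvg Phic) (@continuous_horner _ p c)).
- by exists (horner p^`()) => // x _; exact: is_derive_poly.
Qed.

Lemma jet_eq_on m f g p : (forall x, a < x < b -> f x = g x) ->
  jet m f p -> jet m g p.
Proof.
move=> fg; have cvgE : f @ Phi --> p.[c] -> g @ Phi --> p.[c].
  move=> fp; apply: cvg_trans fp; apply: near_eq_cvg.
  by apply: filterS (one_sided_itv Phic) => x /fg.
case: m => [|m] [fp]; first by move=> _; split=> //; exact: cvgE.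
move=> [f' f'E f'p]; split; first exact: cvgE.
exists f' => // x xab; apply: near_eq_is_derive (f'E _ xab).
by apply: filterS (near_itv xab) => y /fg.
Qed.

Lemma jetD m f g p q : jet m f p -> jet m g q ->
  jet m (fun x => f x + g x) (p + q).
Proof.
elim: m f g p q => [|m IHm] f g p q [fp f'] [gq g'].
  by split=> //; rewrite hornerD; exact: cvgD.
split; first by rewrite hornerD; exact: cvgD.
case: f' g' => f' f'E f'p [g' g'E g'q].
exists (fun x => f' x + g' x); last by rewrite derivD; exact: IHm.
by move=> x xab; apply: is_deriveD; [exact: f'E|exact: g'E].
Qed.

Lemma jetM m f g p q : jet m f p -> jet m g q ->
  jet m (fun x => f x * g x) (p * q).
Proof.
elim: m f g p q => [|m IHm] f g p q fp gq.
  by split=> //; rewrite hornerM; apply: cvgM; [apply: jet_cvg fp|apply: jet_cvg gq].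
split; first by rewrite hornerM; apply: cvgM; [apply: jet_cvg fp|apply: jet_cvg gq].
case: (fp) (gq) => _ [f' f'E f'p] [_ [g' g'E g'q]].
exists (fun x => f' x * g x + f x * g' x).
  move=> x xab; have := is_deriveM (f'E _ xab) (g'E _ xab).
  move=> h; apply: trigger_derive h _.
  by rewrite /GRing.scale/= addrC mulrC.
by rewrite derivM; apply: jetD; apply: IHm => //; exact: jetW.
Qed.

Lemma jet_sum m (n : nat) (f : 'I_n -> R -> R) (p : 'I_n -> {poly R}) :
  (forall j, jet m (f j) (p j)) ->
  jet m (fun x => \sum_(j < n) f j x) (\sum_(j < n) p j).
Proof.
elim: n f p => [|n IHn] f p fp.
  rewrite big_ord0; apply: jet_eq_on (jet_poly m 0) => x _.
  by rewrite horner0 big_ord0.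
rewrite big_ord_recl;
apply: jet_eq_on (jetD (fp ord0)
  (IHn _ _ (fun j => fp (lift ord0 j)))) => x _.
by rewrite big_ord_recl.
Qed.

(** The two polynomials have the same derivatives at c up to order m. *)
Lemma jet_congr m f p q : ('X - c%:P) ^+ m.+1 %| p - q ->
  jet m f p -> jet m f q.
Proof.
move=> dvd; have eqc (n : nat) r s : ('X - c%:P) ^+ n.+1 %| r - s -> r.[c] = s.[c].
  move=> /dvdp_XsubC_expP /(_ 0%N isT); rewrite derivn0 hornerD hornerN.
  by move/eqP; rewrite subr_eq0 => /eqP.
elim: m f p q dvd => [|m IHm] f p q dvd.
  by rewrite /= (eqc _ _ _ dvd).
move=> [fp [f' f'E f'p]]; split; first by rewrite -(eqc _ _ _ dvd).
exists f' => //; apply: IHm f'p; rewrite -derivB; exact: dvdp_XsubC_exp_deriv.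
Qed.

Lemma jet_derive1n i m f p : jet (i + m) f p -> jet m (derive1n i f) p^`(i).
Proof.
elim: i f p => [|i IHi] f p //; rewrite addSn => -[_ [f' f'E f'p]].
rewrite derive1Sn derivSn; apply: IHi; apply: jet_eq_on f'p => x xab.
by rewrite derive1E; have [_ ->] := f'E _ xab.
Qed.

Lemma jet_lim i m f p : (i <= m)%N -> jet m f p ->
  derive1n i f @ Phi --> (p^`(i)).[c].
Proof.
move=> im; rewrite -(subnKC im) => /jet_derive1n; exact: jet_cvg.
Qed.

End JetTheory.
End Jets.

Section JetComposition.
Context {R : realType}.

Lemma jet_affine (a b c a' b' c' u v : R) (Phi Phi' : set_system R) m
    (f : R -> R) (p : {poly R}) :
  one_sided a' b' c' Phi' -> u * c' + v = c ->
  (forall x, a' < x < b' -> a < u * x + v < b) ->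
  (fun x => u * x + v) @ Phi' --> Phi ->
  jet a b c Phi m f p ->
  jet a' b' c' Phi' m (fun x => f (u * x + v)) (p \Po (u *: 'X + v%:P)).
Proof.
move=> Phic' cE abP PhiP.
have cvgP (g : R -> R) q : g @ Phi --> q.[c] ->
    (fun x => g (u * x + v)) @ Phi' --> (q \Po (u *: 'X + v%:P)).[c'].
  move=> gq; rewrite horner_comp !hornerE cE.
  by apply: cvg_trans gq; exact: cvg_app PhiP.
elim: m f p => [|m IHm] f p [fp]; first by move=> _; split=> //; exact: cvgP.
move=> [f' f'E f'p]; split; first exact: cvgP.
exists (fun x => f' (u * x + v) * u%:P.[x]).
  move=> x xab; rewrite hornerC.
  apply: (@is_derive1_comp _ f (fun y => u * y + v)); first exact/f'E/abP.
  have : is_derive x 1 (horner (u *: 'X + v%:P)) (u *: 'X + v%:P)^`().[x].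
    exact: is_derive_poly.
  rewrite derivD derivZ derivX derivC !hornerE.
  by congr is_derive; apply/funext => y; rewrite !hornerE.
rewrite deriv_comp derivD derivZ derivX derivC addr0 alg_polyC.
by apply: (jetM Phic'); [exact: IHm|exact: (jet_poly Phic')].
Qed.
End JetComposition.

Section VectorJets.
Context {R : realType}.

Lemma cvg_mx {T : Type} {F : set_system T} {FF : Filter F} m n
    (f : T -> 'M[R]_(m, n)) (l : 'M[R]_(m, n)) :
  (forall i j, (fun x => f x i j) @ F --> l i j) -> f @ F --> l.
Proof.
move=> fl; apply/cvgrPdist_le => /= e e0; near=> x.
rewrite [leLHS]/Num.Def.normr/= mx_normrE (bigmax_le _ (ltW e0))//= => i _.
rewrite !mxE/=; move: i; near: x; apply: filter_forall => /= i.
by move/cvgrPdist_le : (fl i.1 i.2); apply.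
Unshelve. all: by end_near. Qed.

Context {a b c : R} {Phi : set_system R} (Phic : one_sided a b c Phi).
Let PhiP : ProperFilter Phi := one_sided_proper Phic.
#[local] Existing Instance PhiP.

(** Iterated derivatives of a vector function can be taken coordinatewise only
    where they exist, which the jets guarantee. *)
Lemma derive1n_coord d i m (f : R -> 'cV[R]_d) (p : 'cV[{poly R}]_d) j x :
  (i <= m)%N -> a < x < b ->
  (forall j, jet a b c Phi m (fun y => f y j ord0) (p j ord0)) ->
  derive1n i f x j ord0 = derive1n i (fun y => f y j ord0) x.
Proof.
move=> im xab fp; elim: i j x im xab => [//|i IHi] j x im xab.
have near_coord k : \forall y \near x,
    derive1n i (fun y => f y k ord0) y = derive1n i f y k ord0.
  by apply: filterS (near_itv xab) => y yab; rewrite IHi// ltnW.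
have der k : derivable (fun y => derive1n i f y k ord0) x 1.
  apply: near_eq_derivable (near_coord k) _.
  have := fp k; rewrite -(subnKC im) addSnnS => /(jet_derive1n Phic)[_ [f' f'E _]].
  by have [] := f'E _ xab.
rewrite !derive1nS !derive1E derive_mx.
  by rewrite mxE; apply: near_eq_derive; apply: filterS (near_coord j).
by apply/derivable_mxP => k l; rewrite (ord1 l).
Qed.

Lemma jet_lim_vec d i m (f : R -> 'cV[R]_d) (p : 'cV[{poly R}]_d) :
  (i <= m)%N -> (forall j, jet a b c Phi m (fun y => f y j ord0) (p j ord0)) ->
  derive1n i f @ Phi --> horner_cv (map_mx (fun q => q^`(i)) p) c.
Proof.
move=> im fp; apply: cvg_mx => j l; rewrite (ord1 l) !mxE.
apply: cvg_trans (jet_lim Phic im (fp j)); apply: near_eq_cvg.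
by apply: filterS (one_sided_itv Phic) => x xab; rewrite (derive1n_coord _ im xab fp).
Qed.

End VectorJets.

(** * The chain rule from continuous partial derivatives *)

Lemma cvg_near_eq {T : Type} {U : nbhsType} {F : set_system T} {FF : Filter F}
    (f g : T -> U) (l : set_system U) :
  (\forall x \near F, f x = g x) -> f @ F --> l -> g @ F --> l.
Proof. by move=> fg; apply: cvg_trans; exact: near_eq_cvg. Qed.

Section ChainRule.
Context {R : realType} {d : nat}.
Implicit Types (A : set (R * 'cV[R]_d)) (G : R * 'cV[R]_d -> 'cV[R]_d).

(** The mean value theorem applied to g - l * id, in a form that does not
    depend on the sign of the increment. *)
Lemma mean_value_bound (g g' : R -> R) (del l e : R) :
  (forall s : R, `|s| <= `|del| -> is_derive s 1 g (g' s)) ->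
  (forall s : R, `|s| <= `|del| -> `|g' s - l| <= e) ->
  `|g del - g 0 - del * l| <= e * `|del|.
Proof.
move=> gE g'l.
have cts x y : (forall s, x <= s <= y -> `|s| <= `|del|) ->
    {within `[x, y], continuous g}.
  move=> xyd; apply: derivable_within_continuous => s; rewrite in_itv/= => /xyd /gE.
  by move=> [].
have bound s : `|s| <= `|del| -> g del - g 0 = g' s * del ->
    `|g del - g 0 - del * l| <= e * `|del|.
  move=> sd ->; rewrite mulrC -mulrBr normrM mulrC.
  by rewrite ler_wpM2r// g'l.
have [del0|del0] := leP 0 del.
  have sub s : 0 <= s <= del -> `|s| <= `|del|.
    by move=> /andP[s0 sd]; rewrite !ger0_norm.
  have [||s sI] := @MVT_segment _ g g' _ _ del0.
  - by move=> s; rewrite in_itv/= => /andP[s0 sd]; apply/gE/sub; rewrite !ltW.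
  - exact: cts.
  by rewrite subr0; apply: bound; apply: sub; move: sI; rewrite in_itv.
have sub s : del <= s <= 0 -> `|s| <= `|del|.
  by move=> /andP[s0 sd]; rewrite !ler0_norm ?lerN2// ltW.
have [||s sI] := @MVT_segment _ g g' _ _ (ltW del0).
- by move=> s; rewrite in_itv/= => /andP[s0 sd]; apply/gE/sub; rewrite !ltW.
- exact: cts.
rewrite sub0r mulrN => gE'; apply: (bound s).
  by apply: sub; move: sI; rewrite in_itv.
by rewrite -[RHS]opprK -gE' opprB.
Qed.

Lemma is_derive_cvg (f : R -> R) x df :
  (fun h => h^-1 * (f (h + x) - f x)) @ 0^' --> df -> is_derive x 1 f df.
Proof.
move=> fdf.
have fE : (fun h : R => h^-1 *: ((f \o shift x) (h *: 1) - f x)) =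
    (fun h => h^-1 * (f (h + x) - f x)).
  by apply/funext => h /=; rewrite /GRing.scale/= mulr1.
by apply: DeriveDef; rewrite /derivable /derive fE;
  [apply/cvg_ex; exists df|exact: cvg_lim].
Qed.

(** Joint continuity of (w, s) |-> w + s *: v at (z, 0). *)
Lemma near_segment (V : normedModType R) (z v : V) (B : set V) : nbhs z B ->
  exists2 r : R, 0 < r &
    forall w s, `|w - z| < r -> `|s| < r -> B (w + s *: v).
Proof.
move=> /nbhs_normP[e /= e0 zB]; have v0 : 0 < `|v| + 1 by rewrite ltr_wpDl.
exists (Num.min (e / 2) (e / 2 / (`|v| + 1))).
  by rewrite lt_min !divr_gt0.
move=> w s; rewrite !lt_min => /andP[wz _] /andP[_ sv]; apply: zB => /=.
rewrite distrC -addrA (addrC _ (- z)) addrA (splitr e).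
rewrite (le_lt_trans (ler_normD _ _))// ltrD//.
rewrite normrZ; move: sv; rewrite ltr_pdivlMr//; apply: le_lt_trans.
by rewrite ler_wpM2l// lerDl.
Qed.

Lemma is_partial_coord A v G G' w i (s : R) :
  is_partial A v G G' -> nbhs (w + s *: v) A ->
  is_derive s 1 (fun s => G (w + s *: v) i ord0) (G' (w + s *: v) i ord0).
Proof.
move=> GG' wA; apply: is_derive_cvg.
have := GG' _ (nbhs_singleton wA).
have -> : within [set h | A (w + s *: v + h *: v)] 0^' = 0^'.
  have [r r0 wB] := near_segment v wA.
  have A0 : \forall h \near 0^', A (w + s *: v + h *: v).
    apply: nbhs_dnbhs; apply/nbhs_normP; exists r => //= h.
    by rewrite /ball_ /= ?sub0r ?normrN => hr; apply: wB => //; rewrite subrr normr0.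
  rewrite predeqE => B; split; last exact: cvg_within.
  by rewrite /within/= => BA; apply: filterS2 A0 BA => h Ah; apply.
move=> h; have {}h := cvg_comp _ _ h (@coord_continuous _ d 1 i ord0 _).
apply: cvg_near_eq h; apply: nearW => h /=.
by rewrite !mxE (addrC h) scalerDl addrA.
Qed.

(** A moving increment: along a path c(h) tending to z, the increment of G over
    del(h) *: v is asymptotic to del(h) times the partial derivative at z. Since
    the base point moves, existence of the partial derivative at z is not
    enough; its continuity near z, through the mean value theorem, is what makes
    the estimate uniform. *)
Lemma partial_increment A v G G' (z : R * 'cV[R]_d) i
    (c : R -> R * 'cV[R]_d) (del : R -> R) (dd : R) :
  nbhs z A -> is_partial A v G G' -> {within A, continuous G'} ->
  c @ 0^' --> z -> (fun h => h^-1 * del h) @ 0^' --> dd ->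
  (fun h => h^-1 * (G (c h + del h *: v) i ord0 - G (c h) i ord0)) @ 0^'
    --> dd * G' z i ord0.
Proof.
move=> zA GG' G'c cz deldd; set l := G' z i ord0.
have G'z : (fun w => G' w i ord0) @ z --> l.
  have : G' @ z --> G' z.
    have := (subspace_continuousP _ _).1 G'c z (nbhs_singleton zA).
    by rewrite within_interior.
  by move=> h; exact: (cvg_comp _ _ h (@coord_continuous _ d 1 i ord0 _)).
have del0 : del @ 0^' --> (0 : R).
  have : (fun h => h * (h^-1 * del h)) @ 0^' --> 0 * dd.
    by apply: cvgM deldd; exact: nbhs_dnbhs.
  rewrite mul0r; apply: cvg_near_eq.
  have : \forall h \near (0:R)^', h != 0 by exact: nbhs_dnbhs_neq.
  by apply: filterS => h h0; rewrite mulVKf.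
suff err : (fun h => h^-1 * (G (c h + del h *: v) i ord0 - G (c h) i ord0)
                     - h^-1 * del h * l) @ 0^' --> 0.
  rewrite -[X in _ --> X]add0r.
  apply: cvg_near_eq (cvgD err (cvgM deldd (cvg_cst l))); apply: nearW => h /=.
  by rewrite /= subrK.
apply/cvgrPdist_le => /= e e0.
have dd0 : 0 < `|dd| + 1 by rewrite ltr_wpDl.
pose e' := e / (`|dd| + 1); have e'0 : 0 < e' by rewrite divr_gt0.
have zB : nbhs z [set w | nbhs w A /\ `|G' w i ord0 - l| <= e'].
  apply: filterI; first exact: nbhs_interior.
  move/cvgrPdist_le : G'z => /(_ _ e'0); apply: filterS => w.
  by rewrite distrC.
have [r r0 Br] := near_segment v zB.
near=> h.
rewrite sub0r normrN -mulrA -mulrBr normrM.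
have hc : `|c h - z| < r.
  rewrite distrC; near: h.
  by move/cvgrPdist_lt : cz; apply.
have hd : `|del h| < r.
  rewrite -normrN -sub0r; near: h.
  by move/cvgrPdist_lt : del0; apply.
have hq : `|h^-1 * del h| <= `|dd| + 1.
  near: h; move/cvgrPdist_le : deldd => /(_ 1 ltr01); apply: filterS => h.
  by rewrite distrC -lerBlDl; apply: le_trans; exact: lerB_dist.
have := @mean_value_bound (fun s => G (c h + s *: v) i ord0)
  (fun s => G' (c h + s *: v) i ord0) (del h) l e'.
rewrite scale0r addr0 => bound.
have {}bound : `|G (c h + del h *: v) i ord0 - G (c h) i ord0 - del h * l| <=
    e' * `|del h|.
  by apply: bound => s sd; have [sA sl] := Br _ _ hc (le_lt_trans sd hd);
    [exact: is_partial_coord GG' sA|].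
apply: le_trans (ler_wpM2l (normr_ge0 _) bound) _.
rewrite mulrCA -normrM /e' mulrAC ler_pdivrMr// ler_wpM2l// ltW.
Unshelve. all: by end_near. Qed.

End ChainRule.

Section JetsAlongCurves.
Context {R : realType} {d : nat}.
Implicit Types (A : set (R * 'cV[R]_d)) (G : R * 'cV[R]_d -> 'cV[R]_d).
Implicit Types p q : 'cV[{poly R}]_d.

Lemma cvg_sum_ord {T : Type} {F : set_system T} {FF : Filter F} n
    (f : 'I_n -> T -> R) (l : 'I_n -> R) :
  (forall j, f j @ F --> l j) ->
  (fun x => \sum_(j < n) f j x) @ F --> \sum_(j < n) l j.
Proof.
elim: n f l => [|n IHn] f l fl.
  by rewrite big_ord0; under eq_fun do rewrite big_ord0; exact: cvg_cst.
rewrite big_ord_recl; under eq_fun do rewrite big_ord_recl.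
by apply: cvgD (fl ord0) (IHn _ _ _) => j; exact: fl.
Qed.

(** Continuous partial derivatives give the chain rule: the increment of
    G(y, p(y)) is split into a staircase that moves one coordinate at a time, and
    [partial_increment] handles each step. *)
Lemma is_derive_along_curve A G Gt (Gx : 'I_d -> R * 'cV[R]_d -> 'cV[R]_d) p
    (x : R) i :
  nbhs (x, horner_cv p x) A ->
  is_partial A (1, 0) G Gt -> {within A, continuous Gt} ->
  (forall j, is_partial A (0, delta_mx j ord0) G (Gx j)) ->
  (forall j, {within A, continuous (Gx j)}) ->
  is_derive x 1 (fun y => G (y, horner_cv p y) i ord0)
    (Gt (x, horner_cv p x) i ord0 +
     \sum_(j < d) (p j ord0)^`().[x] * Gx j (x, horner_cv p x) i ord0).
Proof.
set z := (x, horner_cv p x) => zA Gt_part Gt_cont Gx_part Gx_cont.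
(* After n steps the time and the first n coordinates have been moved. *)
pose stair (n : nat) (h : R) : R * 'cV[R]_d :=
  (h + x, \col_k (if (k < n)%N then (p k ord0).[h + x] else (p k ord0).[x])).
pose del (j : 'I_d) (h : R) := (p j ord0).[h + x] - (p j ord0).[x].
have shift_cvg : (fun h => h + x) @ 0^' --> x.
  rewrite -[X in _ --> X]add0r; apply: cvgD; last exact: cvg_cst.
  exact: nbhs_dnbhs.
have stair_cvg n : stair n @ 0^' --> z.
  apply: (@cvg_pair _ _ _ _ (nbhs x) (nbhs (horner_cv p x))) => //.
  apply: cvg_mx => k l.
  rewrite (ord1 l) mxE; case: (ltnP k n) => kn.
    apply: (@cvg_near_eq _ _ _ _ (fun h => (p k ord0).[h + x])).
      by apply: nearW => h; rewrite mxE kn.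
    exact: (cvg_comp _ _ shift_cvg (@continuous_horner _ _ _)).
  apply: (@cvg_near_eq _ _ _ _ (cst (p k ord0).[x])); last exact: cvg_cst.
  by apply: nearW => h; rewrite mxE ltnNge kn.
have stairS (j : 'I_d) h :
    stair j.+1 h = stair j h + del j h *: ((0, delta_mx j ord0) : R * 'cV[R]_d).
  congr pair; first by rewrite /= scaler0 addr0.
  apply/colP => k; rewrite !mxE eqxx andbT ltnS leq_eqVlt.
  have [->|kj] := eqVneq k j; first by rewrite eqxx ltnn mulr1 addrC subrK.
  by rewrite val_eqE (negPf kj) mulr0 addr0.
have stair0 h : stair 0%N h = z + h *: ((1, 0) : R * 'cV[R]_d).
  congr pair; first by rewrite /= /GRing.scale/= mulr1 addrC.
  by apply/colP => k; rewrite !mxE mulr0 addr0.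
have staird h : stair d h = (h + x, horner_cv p (h + x)).
  by congr pair; apply/colP => k; rewrite !mxE ltn_ord.
have split_incr h : G (h + x, horner_cv p (h + x)) i ord0 - G z i ord0 =
    (G (z + h *: ((1, 0) : R * 'cV[R]_d)) i ord0 - G z i ord0) +
    \sum_(j < d) (G (stair j h + del j h *: ((0, delta_mx j ord0) : R * 'cV[R]_d))
                    i ord0 - G (stair j h) i ord0).
  under eq_bigr do rewrite -stairS.
  rewrite -(big_mkord xpredT (fun j => G (stair j.+1 h) i ord0 - G (stair j h) i ord0)).
  by rewrite telescope_sumr// staird stair0 [RHS]addrC subrKA.
apply: is_derive_cvg.
have t_cvg : (fun h => h^-1 * (G (z + h *: ((1, 0) : R * 'cV[R]_d)) i ord0
    - G z i ord0)) @ 0^' --> Gt z i ord0.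
  rewrite -[X in _ --> X]mul1r.
  apply: (partial_increment (c := cst z) (del := id) zA Gt_part Gt_cont).
    exact: cvg_cst.
  apply: (@cvg_near_eq _ _ _ _ (fun=> 1 : R)); last exact: cvg_cst.
  have : \forall h \near (0:R)^', h != 0 by exact: nbhs_dnbhs_neq.
  by apply: filterS => h h0; rewrite mulVf.
have x_cvg (j : 'I_d) : (fun h => h^-1 * (G (stair j h + del j h *:
    ((0, delta_mx j ord0) : R * 'cV[R]_d)) i ord0 - G (stair j h) i ord0))
    @ 0^' --> (p j ord0)^`().[x] * Gx j z i ord0.
  apply: (partial_increment zA (Gx_part j) (Gx_cont j) (stair_cvg j)).
  have [pd <-] := is_derive_poly (p j ord0) x.
  apply: cvg_near_eq pd; apply: nearW => h /=.
  by rewrite /del /GRing.scale/= mulr1.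
apply: cvg_near_eq (cvgD t_cvg (cvg_sum_ord x_cvg)); apply: nearW => h /=.
by rewrite split_incr mulrDr mulr_sumr.
Qed.

Lemma Cq_on_continuous A m G : Cq_on A m G -> {within A, continuous G}.
Proof. by case: m => [|m] []. Qed.

Lemma Cq_on_partials A m G : Cq_on A m.+1 G ->
  exists Gt (Gx : 'I_d -> R * 'cV[R]_d -> 'cV[R]_d),
    [/\ is_partial A (1, 0) G Gt, Cq_on A m Gt,
        forall j, is_partial A (0, delta_mx j ord0) G (Gx j) &
        forall j, Cq_on A m (Gx j)].
Proof.
move=> [_ partials].
have [Gt Gt_part Gt_Cq] := partials (1, 0) (or_introl erefl).
have Gx_ex (j : 'I_d) := partials _ (or_intror (ex_intro _ j erefl)).
exists Gt, (fun j => sval (cid2 (Gx_ex j))).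
by split=> // j; case: (cid2 (Gx_ex j)).
Qed.

Context {a b c : R} {Phi : set_system R} (Phic : one_sided a b c Phi).
Let PhiP : ProperFilter Phi := one_sided_proper Phic.
#[local] Existing Instance PhiP.

(** The derivatives of G(x, p(x)) at an endpoint involve those of p only up to
    the same order; hence two curves with contact of order m yield a common jet.
    By induction on m: the chain rule expresses the derivative through the
    partial derivatives of G, which have one degree of smoothness less, and
    through the derivatives of p and q, whose contact has order one less. *)
Lemma jet_along_curves A m G p q :
  (forall (x : R) (y : 'cV[R]_d), a < x < b -> nbhs (x, y) A) ->
  (forall y, A (c, y)) ->
  Cq_on A m G ->
  (forall j, ('X - c%:P) ^+ m.+1 %| p j ord0 - q j ord0) ->
  forall i, exists P,
    jet a b c Phi m (fun x => G (x, horner_cv p x) i ord0) P /\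
    jet a b c Phi m (fun x => G (x, horner_cv q x) i ord0) P.
Proof.
move=> Aitv Ac.
have G_cvg (H : R * 'cV[R]_d -> 'cV[R]_d) r i : {within A, continuous H} ->
    (fun x => H (x, horner_cv r x) i ord0) @ Phi --> H (c, horner_cv r c) i ord0.
  move=> /(subspace_continuousP _ _).1/(_ _ (Ac _)) Hc.
  have path : (fun x => (x, horner_cv r x)) @ Phi `=>`
      within A (nbhs (c, horner_cv r c)).
    have path_cvg : (fun x => (x, horner_cv r x)) @ Phi --> (c, horner_cv r c).
      apply: (@cvg_pair _ _ _ _ (nbhs c) (nbhs (horner_cv r c))).
        exact: one_sided_cvg Phic.
      apply: cvg_mx => k l; rewrite (ord1 l) mxE.
      apply: (@cvg_near_eq _ _ _ _ (horner (r k ord0))).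
        by apply: nearW => x; rewrite mxE.
      exact: (cvg_comp _ _ (one_sided_cvg Phic) (@continuous_horner _ _ _)).
    move=> B /path_cvg; apply: filterS2 (one_sided_itv Phic) => x xab; apply.
    exact: nbhs_singleton (Aitv _ _ xab).
  have {}Hc := cvg_comp _ _ path (Hc _).
  exact: (cvg_comp _ _ Hc (@coord_continuous _ d 1 i ord0 _)).
elim: m G p q => [|m IHm] G p q G_Cq pq i.
  have G_cont := Cq_on_continuous G_Cq.
  exists (G (c, horner_cv p c) i ord0)%:P; rewrite /= hornerC.
  split; split=> //; first exact: G_cvg.
  suff -> : horner_cv p c = horner_cv q c by exact: G_cvg.
  apply/colP => j; rewrite !mxE; apply/eqP; rewrite -subr_eq0 -hornerN -hornerD.
  by have := pq j; rewrite expr1 dvdp_XsubCl.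
have [Gt [Gx [Gt_part Gt_Cq Gx_part Gx_Cq]]] := Cq_on_partials G_Cq.
have pq' j : ('X - c%:P) ^+ m.+1 %| p j ord0 - q j ord0.
  by apply: dvdp_trans (pq j); rewrite [X in _ %| X]exprS dvdp_mull.
have [Pt [Ptp Ptq]] := IHm _ _ _ Gt_Cq pq' i.
have Px_ex j := IHm _ _ _ (Gx_Cq j) pq' i.
pose Px j := sval (cid (Px_ex j)).
have Pxp j : jet a b c Phi m (fun x => Gx j (x, horner_cv p x) i ord0) (Px j).
  by rewrite /Px; case: (cid _) => ? [].
have Pxq j : jet a b c Phi m (fun x => Gx j (x, horner_cv q x) i ord0) (Px j).
  by rewrite /Px; case: (cid _) => ? [].
have [P PE] := poly_antiderivative (Pt + \sum_(j < d) (p j ord0)^`() * Px j).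
(* The primitive P is fixed up to a constant, set by the limit at c. *)
have jet' r : jet a b c Phi m (fun x => Gt (x, horner_cv r x) i ord0) Pt ->
    (forall j, jet a b c Phi m (fun x => Gx j (x, horner_cv r x) i ord0) (Px j)) ->
    (forall j, ('X - c%:P) ^+ m.+2 %| r j ord0 - p j ord0) ->
    jet a b c Phi m.+1 (fun x => G (x, horner_cv r x) i ord0)
      (P + (G (c, horner_cv p c) i ord0 - P.[c])%:P).
  move=> Ptr Pxr rp; split.
    rewrite hornerD hornerC addrC subrK.
    suff <- : horner_cv r c = horner_cv p c.
      exact/G_cvg/(Cq_on_continuous G_Cq).
    apply/colP => j; rewrite !mxE; apply/eqP; rewrite -subr_eq0 -hornerN -hornerD.
    rewrite -/(root _ _) -dvdp_XsubCl; apply: dvdp_trans (rp j).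
    by rewrite exprS dvdp_mulr.
  exists (fun x => Gt (x, horner_cv r x) i ord0 +
      \sum_(j < d) (r j ord0)^`().[x] * Gx j (x, horner_cv r x) i ord0).
    move=> x xab; apply: (is_derive_along_curve _ (Aitv _ _ xab) Gt_part _ Gx_part).
      exact: Cq_on_continuous Gt_Cq.
    by move=> j; exact: Cq_on_continuous (Gx_Cq j).
  rewrite derivD derivC addr0 PE.
  apply: (jet_congr _ (jetD Phic Ptr (jet_sum Phic (fun j =>
    jetM Phic (jet_poly Phic m (r j ord0)^`()) (Pxr j))))).
  rewrite opprD addrACA subrr add0r -sumrB.
  apply: (big_ind (dvdp (('X - c%:P) ^+ m.+1))) => [|u v|j _];
    [exact: dvdp0|exact: dvdp_add|].
  by rewrite -mulrBl -derivB dvdp_mulr// dvdp_XsubC_exp_deriv.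
exists (P + (G (c, horner_cv p c) i ord0 - P.[c])%:P); split; apply: jet' => // j.
  by rewrite subrr dvdp0.
by rewrite -dvdpNr opprB.
Qed.

End JetsAlongCurves.

(** * Hermite interpolation *)

Section HermiteData.
Context {R : realType}.
Implicit Types (p q P : {poly R}) (xs : seq R) (f : R -> R).

Definition inner_nodes (a b : R) xs := uniq xs /\ forall x, x \in xs -> a < x < b.

Definition node_poly xs : {poly R} := \prod_(x <- xs) ('X - x%:P).

(** The quadrature points, counted with multiplicity, are the roots of this
    polynomial: uphalf k is the multiplicity of the left endpoint and k./2.+1
    that of the right one. *)
Definition quad_poly (k : nat) (a b : R) xs : {poly R} :=
  ('X - a%:P) ^+ uphalf k * ('X - b%:P) ^+ k./2.+1 * node_poly xs.

(** P carries the Hermite data that the quadrature rule reads off f. The guard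
    0 < k is needed because for k = 0 the multiplicity of the left endpoint is 0
    and its predecessor would still demand convergence there. *)
Definition interpolates (k : nat) (a b : R) xs f P :=
  [/\ (0 < k)%N -> jet a b a a^'+ (uphalf k).-1 f P,
      jet a b b b^'- k./2 f P &
      forall x, x \in xs -> P.[x] = f x].

Lemma root_node_poly xs x : root (node_poly xs) x = (x \in xs).
Proof. by rewrite root_prod_XsubC. Qed.

Lemma size_node_poly xs : size (node_poly xs) = (size xs).+1.
Proof. by rewrite size_prod_XsubC. Qed.

Lemma node_poly_monic xs : node_poly xs \is monic.
Proof. exact: monic_prod_XsubC. Qed.

Lemma uphalf_half_sum k : (uphalf k + k./2 = k)%N.
Proof. by rewrite uphalf_half -addnA addnn odd_double_half. Qed.

Lemma quad_poly_monic k a b xs : quad_poly k a b xs \is monic.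
Proof.
by rewrite !(rpredM, rpredX) ?monicXsubC ?node_poly_monic.
Qed.

Lemma size_quad_poly k a b xs : size (quad_poly k a b xs) = (k + size xs).+2.
Proof.
rewrite size_Mmonic ?node_poly_monic ?monic_neq0 ?rpredM ?rpredX ?monicXsubC//.
rewrite size_Mmonic ?monic_neq0 ?rpredX ?monicXsubC// !size_exp_XsubC size_node_poly.
by rewrite -[in RHS](uphalf_half_sum k); lia.
Qed.

Context {a b : R} (ab : a < b).

Lemma coprime_ends m n : coprimep (('X - a%:P) ^+ m) (('X - b%:P) ^+ n).
Proof.
by apply/coprimep_expl/coprimep_expr/coprimep_XsubC2; rewrite subr_eq0 gt_eqF.
Qed.

Lemma coprime_end_node (c : R) m xs : c \notin xs ->
  coprimep (('X - c%:P) ^+ m) (node_poly xs).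
Proof.
move=> cxs; apply: coprimep_expl.
by rewrite coprimep_sym coprimep_XsubC root_node_poly.
Qed.

Lemma inner_nodes_ends xs : inner_nodes a b xs -> (a \notin xs) /\ (b \notin xs).
Proof.
by move=> [_ xsab]; split; apply/negP => /xsab; rewrite ltxx ?andbF.
Qed.

Lemma dvdp_quad_poly k xs p : inner_nodes a b xs ->
  quad_poly k a b xs %| p <->
  [/\ ('X - a%:P) ^+ uphalf k %| p, ('X - b%:P) ^+ k./2.+1 %| p &
      forall x, x \in xs -> root p x].
Proof.
move=> xsab; have [axs bxs] := inner_nodes_ends xsab.
rewrite /quad_poly Gauss_dvdp; last first.
  by rewrite coprimepMl !coprime_end_node.
rewrite Gauss_dvdp ?coprime_ends//; split.
  move=> /andP[/andP[-> ->] dvd]; split=> // x xxs.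
  by rewrite -dvdp_XsubCl; apply: dvdp_trans dvd; rewrite dvdp_XsubCl root_node_poly.
move=> [-> -> rt] /=; apply: uniq_roots_dvdp; first exact/allP.
by rewrite uniq_rootsE; case: xsab.
Qed.

(** Newton's form: each new node x is reached by adding a multiple of a
    polynomial that vanishes at all earlier data and not at x. *)
Lemma newton_extension m p xs f : uniq xs -> (forall x, x \in xs -> ~~ root m x) ->
  exists2 q, m %| q - p & forall x, x \in xs -> q.[x] = f x.
Proof.
elim: xs => [_ _|x xs IHxs /= /andP[xxs uxs] mxs].
  by exists p => //; rewrite subrr dvdp0.
have [|q mq qf] := IHxs uxs; first by move=> y yxs; apply: mxs; rewrite inE yxs orbT.
pose w := m * node_poly xs.
have wx : w.[x] != 0.
  by rewrite -/(root _ _) rootM root_node_poly negb_or xxs mxs ?mem_head.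
exists (q + ((f x - q.[x]) / w.[x]) *: w).
  by rewrite addrAC dvdp_add// -mul_polyC dvdp_mull// dvdp_mulr.
move=> y; rewrite inE => /predU1P[->|yxs].
  by rewrite hornerD hornerZ divfK// addrC subrK.
have /rootP ny : root (node_poly xs) y by rewrite root_node_poly.
by rewrite hornerD hornerZ [w.[y]]hornerM ny !mulr0 addr0 qf.
Qed.

(** Chinese remaindering for the two endpoints, then Newton's form for the inner
    nodes. *)
Lemma hermite_interpolation k xs (f : R -> R) Pa Pb : inner_nodes a b xs ->
  exists P, [/\ ('X - a%:P) ^+ uphalf k %| Pa - P, ('X - b%:P) ^+ k./2.+1 %| Pb - P &
               forall x, x \in xs -> P.[x] = f x].
Proof.
move=> xsab; have [axs bxs] := inner_nodes_ends xsab.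
have /Bezout_eq1_coprimepP[[u v] /= uv1] := coprime_ends (uphalf k) k./2.+1.
set A := ('X - a%:P) ^+ _ in uv1 *; set B := ('X - b%:P) ^+ _ in uv1 *.
have mxs x : x \in xs -> ~~ root (A * B) x.
  move=> xxs; rewrite /root hornerM !horner_exp !hornerXsubC.
  rewrite mulf_neq0// expf_neq0// subr_eq0; first by apply: contraNneq axs => <-.
  by apply: contraNneq bxs => <-.
have [P ABP Pf] := newton_extension (u * A * Pb + v * B * Pa) f xsab.1 mxs.
have Pa_eq : A %| Pa - P.
  rewrite -dvdpNr opprB.
  have -> : P - Pa = P - (u * A * Pb + v * B * Pa) + u * A * (Pb - Pa).
    by rewrite -[in LHS](mul1r Pa) -uv1; ring.
  apply: dvdp_add; first exact: dvdp_trans (dvdp_mulr _ (dvdpp _)) ABP.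
  exact/dvdp_mulr/dvdp_mull.
have Pb_eq : B %| Pb - P.
  rewrite -dvdpNr opprB.
  have -> : P - Pb = P - (u * A * Pb + v * B * Pa) + v * B * (Pa - Pb).
    by rewrite -[in LHS](mul1r Pb) -uv1; ring.
  apply: dvdp_add; first exact: dvdp_trans (dvdp_mull _ (dvdpp _)) ABP.
  exact/dvdp_mulr/dvdp_mull.
by exists P.
Qed.

End HermiteData.

(** * The reference interval *)

Section ReferenceInterval.
Context {R : realType}.
Implicit Types (p q P : {poly R}) (f : R -> R) (a b : R).

Lemma from_refE a b x : from_ref a b x = (b - a) / 2 * x + (a + b) / 2.
Proof. by rewrite /from_ref; field. Qed.

(** [from_ref] as a polynomial, so that pulling back to the reference interval is
    polynomial composition. *)
Definition from_ref_poly a b : {poly R} := ((b - a) / 2) *: 'X + ((a + b) / 2)%:P.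

Lemma horner_from_ref_poly a b x : (from_ref_poly a b).[x] = from_ref a b x.
Proof. by rewrite from_refE !hornerE. Qed.

Lemma to_refE a b : to_ref a b = (2 / (b - a)) *: 'X + (- ((a + b) / (b - a)))%:P.
Proof.
rewrite /to_ref scalerBr scalerA mulrC; congr (_ + _).
by rewrite -mul_polyC -polyCM -polyCN mulrC.
Qed.

Lemma size_affine (s t : R) : s != 0 -> size (s *: 'X + t%:P) = 2%N.
Proof.
move=> s0; rewrite size_polyDl size_scale ?size_polyX//.
by rewrite (leq_ltn_trans (size_polyC_leq1 _)).
Qed.

Lemma dvdp_comp_affine m (c c' s t : R) p : s * c' + t = c ->
  ('X - c%:P) ^+ m %| p -> ('X - c'%:P) ^+ m %| p \Po (s *: 'X + t%:P).
Proof.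
move=> <- /dvdpP[q ->]; rewrite comp_polyM dvdp_mull// rmorphXn/= dvdp_exp2r//.
rewrite comp_polyB comp_polyX comp_polyC dvdp_XsubCl /root !hornerE.
by rewrite subrr.
Qed.

(** Multiplicities of roots are invariant under an affine change of variable;
    applied in both directions between [a, b] and the reference interval. *)
Lemma quad_poly_comp_affine k a b a' b' xs xs' (s t : R) p :
  a < b -> a' < b' -> inner_nodes a b xs -> inner_nodes a' b' xs' ->
  s * a' + t = a -> s * b' + t = b -> (forall x, x \in xs' -> s * x + t \in xs) ->
  quad_poly k a b xs %| p ->
  quad_poly k a' b' xs' %| p \Po (s *: 'X + t%:P).
Proof.
move=> ab ab' xsP xsP' aE bE xsE /(dvdp_quad_poly ab _ _ xsP)[pa pb pxs].
apply/(dvdp_quad_poly ab' _ _ xsP'); split;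
  [exact: dvdp_comp_affine pa|exact: dvdp_comp_affine pb|].
by move=> x /xsE /pxs; rewrite /root horner_comp !hornerE.
Qed.

Context {a b : R} (ab : a < b) {nodes : seq R} (nodesP : inner_nodes (-1) 1 nodes).
Local Notation xs := (map (from_ref a b) nodes).

Lemma from_ref_itv x : (a < from_ref a b x < b) = (-1 < x < 1).
Proof.
have ba : 0 < b - a by rewrite subr_gt0.
rewrite /from_ref ltr_pdivlMr// ltr_pdivrMr//; congr andb; apply/idP/idP => h; nra.
Qed.

Lemma from_ref_inj : injective (from_ref a b).
Proof.
move=> x y; rewrite !from_refE => /addIr /mulfI; apply.
by rewrite mulf_neq0 ?subr_eq0 ?gt_eqF.
Qed.

Lemma inner_nodes_from_ref : inner_nodes a b xs.
Proof.
case: nodesP => un nab; split; first by rewrite map_inj_uniq//; exact: from_ref_inj.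
by move=> _ /mapP[x xn ->]; rewrite from_ref_itv nab.
Qed.

Lemma to_from_ref_poly p : (p \Po from_ref_poly a b) \Po to_ref a b = p.
Proof.
have ba : b - a != 0 by rewrite subr_eq0 gt_eqF.
rewrite -comp_polyA (_ : _ \Po to_ref a b = 'X) ?comp_polyXr//.
rewrite comp_polyD comp_polyZ comp_polyX comp_polyC to_refE scalerDr scalerA.
rewrite -[X in _ + X + _]mul_polyC -polyCM -addrA -polyCD.
rewrite (_ : _ * (2 / _) = 1); last by field.
by rewrite (_ : _ + _ / 2 = 0) ?addr0 ?scale1r//; field.
Qed.

Lemma interpolates_ref k f P : interpolates k a b xs f P ->
  interpolates k (-1) 1 nodes (f \o from_ref a b) (P \Po from_ref_poly a b).
Proof.
have refE : f \o from_ref a b = (fun x => f ((b - a) / 2 * x + (a + b) / 2)).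
  by apply/funext => x /=; rewrite from_refE.
have lt11 : (-1 : R) < 1 by rewrite (lt_trans _ ltr01)// ltrN10.
have ba2 : 0 < (b - a) / 2 by rewrite divr_gt0// subr_gt0.
have itvE x : -1 < x < 1 -> a < (b - a) / 2 * x + (a + b) / 2 < b.
  by rewrite -from_refE from_ref_itv.
move=> [fa fb fx]; split.
- move=> k0; rewrite refE; apply: (jet_affine _ _ itvE _ (fa k0)).
  + exact: one_sided_right.
  + by field.
  + move=> B; have : (fun x => (b - a) / 2 * x + (a + b) / 2) @ (-1 : R)^'+ --> a.
      rewrite (_ : nbhs a = nbhs ((b - a) / 2 * -1 + (a + b) / 2)); last first.
        by congr nbhs; field.
      apply: cvg_at_right_filter; apply: cvgD; last exact: cvg_cst.
      by apply: cvgM; [exact: cvg_cst|exact: cvg_id].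
    move=> lim /lim; apply: filterS2 (one_sided_itv (one_sided_right lt11)) => x xI.
    by apply; case/andP: (itvE _ xI).
- rewrite refE; apply: (jet_affine _ _ itvE _ fb).
  + exact: one_sided_left.
  + by field.
  + move=> B; have : (fun x => (b - a) / 2 * x + (a + b) / 2) @ (1 : R)^'- --> b.
      rewrite (_ : nbhs b = nbhs ((b - a) / 2 * 1 + (a + b) / 2)); last first.
        by congr nbhs; field.
      apply: cvg_at_left_filter; apply: cvgD; last exact: cvg_cst.
      by apply: cvgM; [exact: cvg_cst|exact: cvg_id].
    move=> lim /lim; apply: filterS2 (one_sided_itv (one_sided_left lt11)) => x xI.
    by apply; case/andP: (itvE _ xI).
- by move=> x xn; rewrite horner_comp horner_from_ref_poly fx// map_f.
Qed.

Lemma vanishes_dvdp r k p : vanishes_at_quad_points r k nodes a b p ->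
  quad_poly k a b xs %| p.
Proof.
move=> [pa pb pn]; apply/(dvdp_quad_poly ab _ _ inner_nodes_from_ref); split=> //.
by move=> _ /mapP[x xn ->]; rewrite -dvdp_XsubCl pn.
Qed.

End ReferenceInterval.

(** * Exactness of the quadrature rule *)

Section QuadratureRule.
Context {R : realType}.
Implicit Types (p q P h : {poly R}) (f : R -> R).

Lemma ltrN11 : (-1 : R) < 1. Proof. by rewrite (lt_trans _ ltr01)// ltrN10. Qed.

Lemma poly_int_comp_affine (a b a' b' s t : R) p : a < b -> a' < b' ->
  s * a' + t = a -> s * b' + t = b ->
  poly_int a b p = s * poly_int a' b' (p \Po (s *: 'X + t%:P)).
Proof.
move=> ab ab' aE bE; have [P <-] := poly_antiderivative p.
have affE : s *: (P^`() \Po (s *: 'X + t%:P)) = (P \Po (s *: 'X + t%:P))^`().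
  by rewrite deriv_comp derivD derivZ derivX derivC addr0 alg_polyC mulrC mul_polyC.
by rewrite -poly_intZ// affE !poly_int_deriv// !horner_comp !hornerE aE bE.
Qed.

Lemma modp_congr p W : W %| p %% W - p.
Proof. by rewrite {2}(divp_eq p W) opprD addrCA subrr addr0 dvdpNr dvdp_mull. Qed.

Section Rule.
Context {r k : nat} {nodes : seq R} (kr : (k <= r)%N)
  (nodesP : is_jacobi_nodes r k nodes).

Lemma jacobi_inner : inner_nodes (-1) 1 nodes.
Proof. by case: nodesP. Qed.

Lemma size_nodes : size nodes = (r - k)%N.
Proof. by case: nodesP. Qed.

Local Notation W := (quad_poly k (-1) 1 nodes).

(** Hermite interpolation as a congruence: this gives both its existence, as a
    remainder modulo [quad_poly], and its uniqueness. *)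
Lemma is_hermite_dvd f P h : interpolates k (-1) 1 nodes f P ->
  is_hermite r k nodes f h <-> (size h <= r.+1)%N /\ W %| h - P.
Proof.
move=> [fl fr fx]; have lt11 := ltrN11.
have lE i : (i < uphalf k)%N -> right_lim (derive1n i f) (-1) = P^`(i).[-1].
  move=> ik; have k0 : (0 < k)%N by rewrite -uphalf_gt0; apply: leq_ltn_trans ik.
  apply: cvg_lim => //; apply: (jet_lim (one_sided_right lt11) _ (fl k0)).
  by rewrite -ltnS prednK ?uphalf_gt0.
have rE i : (i <= k./2)%N -> left_lim (derive1n i f) 1 = P^`(i).[1].
  by move=> ik; apply: cvg_lim => //; exact: (jet_lim (one_sided_left lt11) ik fr).
have subE i x : (h - P)^`(i).[x] = 0 <-> h^`(i).[x] = P^`(i).[x].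
  rewrite derivnB hornerD hornerN; split=> [/eqP|->]; last by rewrite subrr.
  by rewrite subr_eq0 => /eqP.
rewrite (dvdp_quad_poly lt11 _ _ jacobi_inner).
split=> [[sh hl hr hx]|[sh [/dvdp_XsubC_expP hl /dvdp_XsubC_expP hr hx]]]; split=> //.
- split.
  + by apply/dvdp_XsubC_expP => i ik; apply/subE; rewrite hl// lE.
  + by apply/dvdp_XsubC_expP => i ik; apply/subE; rewrite hr// rE.
  + by move=> x xn; rewrite /root hornerD hornerN hx// fx// subrr.
- by move=> i ik; rewrite lE//; apply/subE/hl.
- by move=> i ik; rewrite rE//; apply/subE/hr.
- by move=> x xn; move: (hx x xn); rewrite /root hornerD hornerN subr_eq0 fx// => /eqP.
Qed.

Lemma size_quad_poly_rule a b :
  size (quad_poly k a b (map (from_ref a b) nodes)) = r.+2.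
Proof. by rewrite size_quad_poly size_map size_nodes subnKC. Qed.

Context {a b : R} (ab : a < b).
Local Notation xs := (map (from_ref a b) nodes).

(** The rule sees f only through its Hermite data, so any polynomial of degree at
    most r congruent to an interpolating polynomial may be integrated instead. *)
Lemma quad_interpolates f P q : interpolates k a b xs f P ->
  (size q <= r.+1)%N -> quad_poly k a b xs %| q - P ->
  quad r k nodes a b f = poly_int a b q.
Proof.
move=> fP sq qP; rewrite /quad.
suff -> : hermite_on r k nodes a b f = q by exact: poly_int_obnd.
rewrite /hermite_on /hermite.
have hP := interpolates_ref ab fP.
case: xgetP => [h _ /(is_hermite_dvd _ hP)[sh hdvd]|noh].
  have s0 : 2 / (b - a) != 0 by rewrite mulf_neq0 ?invr_eq0 ?subr_eq0 ?gt_eqF.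
  apply/eqP; rewrite -subr_eq0; apply: contraTT isT => neq0.
  have dvd : quad_poly k a b xs %| (h \Po to_ref a b) - P.
    have -> : (h \Po to_ref a b) - P = (h - (P \Po from_ref_poly a b)) \Po to_ref a b.
      by rewrite comp_polyB to_from_ref_poly.
    rewrite to_refE; apply: (quad_poly_comp_affine ltrN11 ab jacobi_inner _ _ _ _ hdvd).
    - exact: inner_nodes_from_ref jacobi_inner.
    - by field; rewrite subr_eq0 gt_eqF.
    - by field; rewrite subr_eq0 gt_eqF.
    - move=> _ /mapP[x xn ->];
      suff -> : 2 / (b - a) * from_ref a b x - (a + b) / (b - a) = x by [].
      by rewrite /from_ref; field; rewrite subr_eq0 gt_eqF.
  have /dvdp_leq : quad_poly k a b xs %| (h \Po to_ref a b) - q.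
    by rewrite -[_ - q](subrKA P) dvdp_add// -opprB dvdpNr.
  move=> /(_ neq0); rewrite size_quad_poly_rule leqNgt => /negP[].
  rewrite ltnS (leq_trans (size_polyD _ _))// geq_max size_polyN sq andbT.
  by rewrite size_comp_poly2// to_refE size_affine.
exfalso; apply: (noh ((P \Po from_ref_poly a b) %% W)); apply/(is_hermite_dvd _ hP).
split; last exact: modp_congr.
rewrite -ltnS -[X in (_ < X)%N](_ : size W = _); last first.
  by rewrite size_quad_poly size_nodes subnKC.
by rewrite ltn_modp monic_neq0// quad_poly_monic.
Qed.

(** The integrand W * q is, up to a constant, the Jacobi weight times the Jacobi
    polynomial times q: the nodes are all the roots of that polynomial. *)
Lemma jacobi_orthogonal q : (size q <= r - k)%N ->
  poly_int (-1) 1 (W * q) = 0.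
Proof.
case: nodesP => un sn nab [J [sJ Jorth] Jroot] sq.
have JE : J = lead_coef J *: node_poly nodes.
  apply: all_roots_prod_XsubC; [by rewrite sJ sn|exact/allP|by rewrite uniq_rootsE].
have J0 : lead_coef J != 0 by rewrite lead_coef_eq0 -size_poly_gt0 sJ.
move: (lead_coef J) JE J0 => c JE J0.
have : poly_int (-1) 1 ((-1) ^+ k./2.+1 * c *: (W * q)) = 0.
  rewrite -[RHS](Jorth _ sq); apply: eq_Rintegral => x _.
  rewrite JE /quad_poly !(hornerZ, hornerM, horner_exp, hornerXsubC) opprK.
  rewrite (_ : 1 - x = -1 * (x - 1)) ?exprMn; last by ring.
  by rewrite (addrC 1 x); ring.
rewrite poly_intZ ?ltrN11// => /eqP.
by rewrite mulf_eq0 mulf_eq0 signr_eq0 (negPf J0) => /eqP.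
Qed.

Lemma quad_poly_int0 p : quad_poly k a b xs %| p ->
  (size p <= 2 * r - k + 1)%N -> poly_int a b p = 0.
Proof.
move=> pdvd sp; have s0 : (b - a) / 2 != 0.
  by rewrite mulf_neq0 ?invr_eq0 ?subr_eq0 ?gt_eqF.
rewrite (poly_int_comp_affine (s := (b - a) / 2) (t := (a + b) / 2) _ ab ltrN11);
  [|by field..].
have /dvdpP[q qE] : W %| p \Po ((b - a) / 2 *: 'X + ((a + b) / 2)%:P).
  apply: (quad_poly_comp_affine ab ltrN11 _ jacobi_inner _ _ _ pdvd).
  - exact: inner_nodes_from_ref jacobi_inner.
  - by field.
  - by field.
  - by move=> x xn; rewrite -from_refE map_f.
rewrite qE (mulrC q); have [->|q0] := eqVneq q 0.
  by rewrite jacobi_orthogonal ?mulr0 ?size_poly0.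
rewrite jacobi_orthogonal ?mulr0//.
have := size_comp_poly2 p (size_affine ((a + b) / 2) s0).
rewrite qE size_Mmonic ?quad_poly_monic// size_quad_poly size_nodes subnKC//.
move: q0 sp; rewrite -size_poly_gt0 => + + sE.
by rewrite -sE; move: (size q) kr => n; lia.
Qed.

Lemma size_modp_quad_poly p :
  (size (p %% quad_poly k a b xs)%R <= r.+1)%N.
Proof.
by rewrite -ltnS -(size_quad_poly_rule a b) ltn_modp monic_neq0 ?quad_poly_monic.
Qed.

Lemma poly_int_modp p : (size p <= 2 * r - k + 1)%N ->
  poly_int a b (p %% quad_poly k a b xs) = poly_int a b p.
Proof.
move=> sp; apply/eqP; rewrite -subr_eq0 -poly_intB//; apply/eqP.
apply: quad_poly_int0; first exact: modp_congr.
rewrite (leq_trans (size_polyD _ _))// geq_max size_polyN sp andbT.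
have [big|small] := leqP (2 * r - k + 1) r.+1; last first.
  exact: leq_trans (size_modp_quad_poly p) (ltnW small).
by rewrite modp_small// size_quad_poly_rule ltnS (leq_trans sp).
Qed.

(** Gauss' argument: the interpolation error is a multiple of [quad_poly] with a
    cofactor of degree less than r - k, hence integrates to 0. *)
Lemma quad_exact f P : interpolates k a b xs f P ->
  (size P <= 2 * r - k + 1)%N -> quad r k nodes a b f = poly_int a b P.
Proof.
move=> fP sP; rewrite (quad_interpolates fP (size_modp_quad_poly P)).
  exact: poly_int_modp.
exact: modp_congr.
Qed.

End Rule.
End QuadratureRule.

(** * The scalar argument on one interval *)

Section LocalStep.
Context {R : realType} {r k : nat} {nodes : seq R} (kr : (k <= r)%N)
  (nodesP : is_jacobi_nodes r k nodes) {a b : R} (ab : a < b).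
Implicit Types (p q phi theta : {poly R}).
Local Notation xs := (map (from_ref a b) nodes).
Local Notation W := (quad_poly k a b xs).
Local Notation L := (node_poly xs).

Let xsP : inner_nodes a b xs := inner_nodes_from_ref ab (jacobi_inner nodesP).

Lemma size_node_poly_rule : size L = (r - k).+1.
Proof. by rewrite size_node_poly size_map (size_nodes nodesP). Qed.

Lemma node_poly_left_neq0 : L.[a] != 0.
Proof. by rewrite -/(root _ _) root_node_poly; case: (inner_nodes_ends xsP). Qed.

(** This integral is, up to a nonzero factor, the quadrature weight of the
    highest derivative at the left endpoint. If it vanished, then replacing
    L by L * L would still give 0, since L - L(a) contributes a multiple of the
    full [quad_poly] with low-degree cofactor; but with L * L the integrand has a
    constant sign. *)
Lemma left_weight_neq0 : (0 < k)%N ->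
  poly_int a b (('X - a%:P) ^+ (uphalf k).-1 * ('X - b%:P) ^+ k./2.+1 * L) != 0.
Proof.
move=> k0; set A := _ ^+ _; set B := _ ^+ _.
have K0 : (0 < uphalf k)%N by rewrite uphalf_gt0.
have WE : W = A * B * L * ('X - a%:P).
  by rewrite /quad_poly -[in LHS](prednK K0) exprSr -/A -/B; ring.
apply/eqP => int0.
have /dvdpP[s sE] : 'X - a%:P %| L - (L.[a])%:P.
  by rewrite dvdp_XsubCl /root !hornerE subrr.
have LE : L = (L.[a])%:P + s * ('X - a%:P) by rewrite -sE addrC subrK.
have ABLL : poly_int a b (A * B * L * L) = 0.
  rewrite {2}LE mulrDr poly_intD// (_ : _ * (s * _) = W * s); last by rewrite WE; ring.
  rewrite mulrC mul_polyC poly_intZ// int0 mulr0 add0r.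
  apply: (quad_poly_int0 kr nodesP ab); first exact: dvdp_mulr.
  have [->|s0] := eqVneq s 0; first by rewrite mulr0 size_poly0.
  have sL : (size (s * ('X - a%:P))%R <= (r - k).+1)%N.
    rewrite -sE (leq_trans (size_polyD _ _))// size_polyN size_node_poly_rule.
    by rewrite geq_max leqnn (leq_trans (size_polyC_leq1 _)).
  move: sL; rewrite size_Mmonic ?monicXsubC// size_XsubC addn2/= ltnS => sL.
  rewrite mulrC size_Mmonic ?quad_poly_monic// (size_quad_poly_rule kr nodesP).
  by move: (size s) sL kr => n; lia.
suff : 0 < poly_int a b ((-1) ^+ k./2.+1 *: (A * B * L * L)).
  by rewrite poly_intZ// ABLL mulr0 ltxx.
have monA : A \is monic by rewrite rpredX ?monicXsubC.
have monB : B \is monic by rewrite rpredX ?monicXsubC.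
apply: poly_int_gt0 => //.
  by rewrite scaler_eq0 signr_eq0/= !mulf_neq0 ?monic_neq0 ?node_poly_monic.
move=> x /andP[ax xb]; have -> : ((-1) ^+ k./2.+1 *: (A * B * L * L)).[x] =
    (x - a) ^+ (uphalf k).-1 * (b - x) ^+ k./2.+1 * L.[x] ^+ 2.
  rewrite (_ : b - x = -1 * (x - b)) ?exprMn; last by ring.
  by rewrite !(hornerZ, hornerM, horner_exp, hornerXsubC); ring.
by rewrite mulr_ge0 ?sqr_ge0// mulr_ge0// exprn_ge0 ?subr_ge0.
Qed.

Lemma size_deriv_leq p : (size p^`() <= (size p).-1)%N.
Proof.
have [->|p0] := eqVneq p 0; first by rewrite deriv0 size_poly0.
by rewrite -ltnS prednK ?size_poly_gt0// lt_size_deriv.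
Qed.

Lemma theta_root_right theta : W %| theta -> theta.[b] = 0.
Proof.
move=> /(dvdp_quad_poly ab _ _ xsP)[_ bt _]; apply/rootP.
by rewrite -dvdp_XsubCl; apply: dvdp_trans bt; rewrite exprS dvdp_mulr.
Qed.

Lemma theta_root_left theta : (0 < k)%N -> W %| theta -> theta.[a] = 0.
Proof.
move=> k0 /(dvdp_quad_poly ab _ _ xsP)[ta _ _]; apply/rootP.
rewrite -dvdp_XsubCl; apply: dvdp_trans ta.
by rewrite -[uphalf k]prednK ?uphalf_gt0// exprS dvdp_mulr.
Qed.

(** Integration by parts: theta vanishes at b, and its product with phi' is
    integrated to 0 by orthogonality. Only a boundary term at a remains, and it
    is the exact price of passing from U to the post-processed solution in the
    variational equation. *)
Lemma poly_int_theta theta phi : (size theta <= r.+2)%N -> W %| theta ->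
  (size phi <= r.+1 - k)%N ->
  poly_int a b (theta^`() * phi) = - (theta.[a] * phi.[a]).
Proof.
move=> st Wt sphi; rewrite poly_int_by_parts// theta_root_right//.
rewrite (quad_poly_int0 kr nodesP ab) ?dvdp_mulr//; first by rewrite mul0r sub0r subr0.
rewrite (leq_trans (size_polyMleq _ _))//.
by move: (size_deriv_leq phi) sphi st kr; lia.
Qed.

(** One interval and one coordinate. Here g stands for M U', gt for M times the
    derivative of the post-processed solution, G for a polynomial with the same
    Hermite data as F(., U), alpha for M a_n and J for M times the jump of U at
    the left endpoint; var_g is the variational equation tested with phi, where
    q is any polynomial of degree at most r that the rule cannot tell from
    G * phi. *)
Section Step.
Context {theta g G : {poly R}} {alpha J : R}.
Context (size_theta : (size theta <= r.+2)%N).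
Context (W_theta : W %| theta).
Context (theta_norm : (theta^`(k./2.+1)).[b] = 1).
Context (size_g : (size g <= r)%N).
Context (alphaE : alpha = - ((g - G)^`(k./2)).[b]).
Context (right_g : ('X - b%:P) ^+ k./2 %| g - G).
Context (left_g : ('X - a%:P) ^+ (uphalf k).-1 %| g - G).
Context (var_g : forall phi q, (size phi <= r.+1 - k)%N ->
  (size q <= r.+1)%N -> W %| q - G * phi ->
  poly_int a b (g * phi) + (k == 0%N)%:R * (J * phi.[a]) = poly_int a b q).

Let gt := g + alpha *: theta^`().

Let W_theta_parts := (dvdp_quad_poly ab _ _ xsP).1 W_theta.

(** The choice of alpha is made for this: it corrects the derivative of order
    k./2 of the residual at b and, since theta vanishes there to that order,
    leaves the lower ones untouched. *)
Lemma step_right : ('X - b%:P) ^+ k./2.+1 %| gt - G.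
Proof.
apply/dvdp_XsubC_expP => i; rewrite ltnS leq_eqVlt /gt addrAC derivnD hornerD.
rewrite derivnZ hornerZ -derivSn => /predU1P[->|ik].
  by rewrite theta_norm mulr1 alphaE subrr.
have [_ /dvdp_XsubC_expP tb _] := W_theta_parts.
by rewrite tb ?ltnS// mulr0 addr0 ((dvdp_XsubC_expP _ _ _).2 right_g _ ik).
Qed.

(** One order short of [step_left]; the last order is not prescribed by the
    original method and comes from the variational equation. *)
Lemma step_left_weak : ('X - a%:P) ^+ (uphalf k).-1 %| gt - G.
Proof.
rewrite /gt addrAC dvdp_add// -mul_polyC dvdp_mull//.
have [ta _ _] := W_theta_parts.
case: (uphalf k) ta => [_|K]; first by rewrite expr0 dvd1p.
exact: dvdp_XsubC_exp_deriv.
Qed.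

Lemma step_defect phi q : (size phi <= r.+1 - k)%N ->
  (size q <= r.+1)%N -> W %| q - G * phi ->
  poly_int a b (gt * phi) =
  poly_int a b q - ((k == 0%N)%:R * J + alpha * theta.[a]) * phi.[a].
Proof.
move=> sphi sq qG; rewrite -(var_g sphi sq qG) /gt mulrDl -scalerAl.
by rewrite poly_intD// poly_intZ// poly_int_theta//; ring.
Qed.

Lemma size_gt_mul phi : (size phi <= r.+1 - k)%N ->
  (size (gt * phi)%R <= 2 * r - k + 1)%N.
Proof.
move=> sphi; rewrite (leq_trans (size_polyMleq _ _))//.
have sgt : (size gt <= r.+1)%N.
  rewrite (leq_trans (size_polyD _ _))// geq_max (leq_trans size_g)//=.
  rewrite (leq_trans (size_scale_leq _ _))// (leq_trans (size_deriv_leq _))//.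
  by move: size_theta; lia.
by move: sphi sgt kr; lia.
Qed.

(** For k = 0, testing with the node polynomial L annihilates the residual at all
    quadrature points, so that the defect has to vanish: the correction closes
    the jump of U. *)
Lemma step_jump : (k == 0%N)%:R * J + alpha * theta.[a] = 0.
Proof.
have [k0|k0] := eqVneq k 0%N; last first.
  by rewrite mul0r add0r theta_root_left ?lt0n// mulr0.
have sL : (size L <= r.+1 - k)%N by rewrite size_node_poly_rule subSn.
have Wdvd : W %| (gt * L) %% W - G * L.
  rewrite -(subrKA (gt * L)) dvdp_add ?modp_congr// -mulrBl.
  have WE : W = ('X - b%:P) ^+ k./2.+1 * L.
    by rewrite /quad_poly (_ : uphalf k = 0%N) ?expr0 ?mul1r// k0.
  by rewrite [X in X %| _]WE dvdp_mul2r ?step_right// monic_neq0 ?node_poly_monic.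
have := step_defect sL (size_modp_quad_poly kr nodesP (gt * L)) Wdvd.
rewrite k0 eqxx -[in X in _ = X - _ -> _]k0.
rewrite (poly_int_modp kr nodesP ab) ?size_gt_mul// => /esym/eqP.
rewrite subr_eq addrC -subr_eq subrr eq_sym mulf_eq0 (negPf node_poly_left_neq0) orbF.
by move=> /eqP.
Qed.

Lemma step_var phi q : (size phi <= r.+1 - k)%N ->
  (size q <= r.+1)%N -> W %| q - G * phi ->
  poly_int a b (gt * phi) = poly_int a b q.
Proof.
by move=> sphi sq qG; rewrite (step_defect sphi sq qG) step_jump mul0r subr0.
Qed.

(** Tested with the node polynomial L, the residual vanishes at all quadrature
    points except for the last derivative at a. Modulo [quad_poly] it is a
    multiple of the integrand of [left_weight_neq0], so the factor must be 0. *)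
Lemma step_left : ('X - a%:P) ^+ uphalf k %| gt - G.
Proof.
have [->|k0] := posnP k; first by rewrite expr0 dvd1p.
have K0 : (0 < uphalf k)%N by rewrite uphalf_gt0.
set A := ('X - a%:P) ^+ (uphalf k).-1; set B := ('X - b%:P) ^+ k./2.+1.
have AE : ('X - a%:P) ^+ uphalf k = ('X - a%:P) * A by rewrite -exprS prednK.
have /dvdpP[s sE] : A * B %| gt - G.
  by rewrite Gauss_dvdp ?coprime_ends// step_left_weak step_right.
suff /dvdpP[u uE] : 'X - a%:P %| s.
  rewrite sE uE AE; have -> : u * ('X - a%:P) * (A * B) = u * B * (('X - a%:P) * A).
    by ring.
  exact: dvdp_mull.
pose W0 := A * B * L.
have sL : (size L <= r.+1 - k)%N by rewrite size_node_poly_rule subSn.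
have WE : W = W0 * ('X - a%:P) by rewrite /quad_poly AE /W0 -/B; ring.
have sW0 : (size W0 <= r.+1)%N.
  have := size_quad_poly_rule kr nodesP a b; rewrite WE size_Mmonic ?monicXsubC//.
    by rewrite size_XsubC addn2 => -[->].
  by rewrite !mulf_neq0 ?expf_neq0 ?polyXsubC_eq0 ?monic_neq0 ?node_poly_monic.
(* q is the Hermite interpolant of G * L. *)
pose q := (gt * L) %% W - s.[a] *: W0.
have sq : (size q <= r.+1)%N.
  rewrite (leq_trans (size_polyD _ _))// geq_max.
  rewrite (size_modp_quad_poly kr nodesP) size_polyN.
  by rewrite /= (leq_trans (size_scale_leq _ _)).
have /dvdpP[u uE] : 'X - a%:P %| s - (s.[a])%:P.
  by rewrite dvdp_XsubCl /root !hornerE subrr.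
have Wdvd : W %| q - G * L.
  have -> : q - G * L = (gt * L) %% W - gt * L + u * W.
    rewrite /q WE -[X in _ = _ + X](_ : (s - (s.[a])%:P) * W0 = _); last first.
      by rewrite uE; ring.
    rewrite mulrBl mul_polyC /W0 mulrA -sE; ring.
  by apply: dvdp_add; [exact: modp_congr|exact: dvdp_mull].
have := step_var sL sq Wdvd.
rewrite /q poly_intB// poly_intZ//.
rewrite (poly_int_modp kr nodesP ab) ?size_gt_mul// => /esym/eqP.
rewrite -subr_eq0 addrAC subrr sub0r oppr_eq0 mulf_eq0.
rewrite (negPf (left_weight_neq0 k0)) orbF.
by rewrite dvdp_XsubCl.
Qed.

End Step.
End LocalStep.

(** * Vectors of polynomials *)

Section VectorPolynomials.
Context {R : realType} {d : nat}.
Implicit Types (p q phi : 'cV[{poly R}]_d) (x : R).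

Definition dotp p q : {poly R} := \sum_(i < d) p i ord0 * q i ord0.

Definition mulcv (M : 'M[R]_d) p : 'cV[{poly R}]_d := map_mx polyC M *m p.

Definition derivcv (i : nat) p : 'cV[{poly R}]_d :=
  map_mx (fun q : {poly R} => q^`(i)) p.

Definition coordcv (j : 'I_d) (q : {poly R}) : 'cV[{poly R}]_d :=
  \col_i (if i == j then q else 0).

Definition addcv p (theta : {poly R}) (v : 'cV[R]_d) : 'cV[{poly R}]_d :=
  \col_j (p j ord0 + v j ord0 *: theta).

Lemma horner_addcv p (theta : {poly R}) v x :
  horner_cv (addcv p theta v) x = horner_cv p x + theta.[x] *: v.
Proof. by apply/colP => j; rewrite !mxE !hornerE mulrC. Qed.

Lemma horner_dotp p q x : (dotp p q).[x] = dot (horner_cv p x) (horner_cv q x).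
Proof.
by rewrite horner_sum; apply: eq_bigr => i _; rewrite hornerM !mxE.
Qed.

Lemma mulcvE M p j : mulcv M p j ord0 = \sum_(i < d) M j i *: p i ord0.
Proof. by rewrite mxE; apply: eq_bigr => i _; rewrite mxE mul_polyC. Qed.

Lemma horner_mulcv M p x : horner_cv (mulcv M p) x = M *m horner_cv p x.
Proof.
apply/colP => j; rewrite mxE mulcvE horner_sum mxE; apply: eq_bigr => i _.
by rewrite hornerZ mxE.
Qed.

Lemma derivcv_mulcv M i p : derivcv i (mulcv M p) = mulcv M (derivcv i p).
Proof.
apply/colP => j; rewrite mxE mulcvE [RHS]mulcvE.
rewrite (big_morph (derivn i) (derivnD i) (linear0 _)).
by apply: eq_bigr => l _; rewrite derivnZ mxE.
Qed.

Lemma derivcvS i p : derivcv i.+1 p = derivcv i (derivcv 1 p).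
Proof. by apply/colP => j; rewrite !mxE derivn1 derivSn. Qed.

Lemma horner_derivcvE i p x j :
  horner_cv (derivcv i p) x j ord0 = ((p j ord0)^`(i)).[x].
Proof. by rewrite !mxE. Qed.

Lemma derivcv0 p : derivcv 0 p = p.
Proof. by apply/colP => j; rewrite mxE. Qed.

Lemma dotp_coordcv p j (q : {poly R}) : dotp p (coordcv j q) = p j ord0 * q.
Proof.
rewrite /dotp (bigD1 j)//= mxE eqxx big1 ?addr0// => i ij.
by rewrite mxE (negPf ij) mulr0.
Qed.

Lemma dot_coordcv (v : 'cV[R]_d) j (q : {poly R}) x :
  dot v (horner_cv (coordcv j q) x) = v j ord0 * q.[x].
Proof.
rewrite /dot (bigD1 j)//= !mxE eqxx big1 ?addr0// => i ij.
by rewrite !mxE (negPf ij) horner0 mulr0.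
Qed.

Lemma size_le_coordcv n j (q : {poly R}) : (size q <= n)%N -> size_le n (coordcv j q).
Proof. by move=> qn i; rewrite mxE; case: ifP => // _; rewrite size_poly0. Qed.

Lemma size_addcv n p (theta : {poly R}) v : size_le n p -> (size theta <= n)%N ->
  size_le n (addcv p theta v).
Proof.
move=> pn tn j; rewrite mxE (leq_trans (size_polyD _ _))// geq_max pn/=.
exact: leq_trans (size_scale_leq _ _) tn.
Qed.

Lemma size_mulcv M n p : size_le n p -> size_le n (mulcv M p).
Proof.
move=> pn j; rewrite mulcvE; apply: (leq_trans (size_sum _ _ _)).
by apply/bigmax_leqP => i _; exact: leq_trans (size_scale_leq _ _) (pn i).
Qed.

Lemma size_dotp m n p q : size_le m p -> size_le n q ->
  (size (dotp p q) <= (m + n).-1)%N.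
Proof.
move=> pm qn; apply: (leq_trans (size_sum _ _ _)); apply/bigmax_leqP => i _.
rewrite (leq_trans (size_polyMleq _ _))//.
by move: (pm i) (qn i); lia.
Qed.

Lemma size_derivcv1 n p : size_le n p -> size_le n.-1 (derivcv 1 p).
Proof.
move=> pn i; rewrite mxE derivn1 (leq_trans (size_deriv_leq _))//.
by move: (pn i); lia.
Qed.

End VectorPolynomials.

Section LimitsOfJets.
Context {R : realType} {d : nat} {a b : R} (ab : a < b).
Implicit Types (f U : R -> 'cV[R]_d) (p P : 'cV[{poly R}]_d).

Lemma left_lim_jet m f P i : (i <= m)%N ->
  (forall j, jet a b b b^'- m (fun y => f y j ord0) (P j ord0)) ->
  left_lim (derive1n i f) b = horner_cv (derivcv i P) b.
Proof.
by move=> im fP; apply: norm_cvg_lim; exact: (jet_lim_vec (one_sided_left ab) im fP).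
Qed.

Lemma right_lim_jet m f P i : (i <= m)%N ->
  (forall j, jet a b a a^'+ m (fun y => f y j ord0) (P j ord0)) ->
  right_lim (derive1n i f) a = horner_cv (derivcv i P) a.
Proof.
by move=> im fP; apply: norm_cvg_lim; exact: (jet_lim_vec (one_sided_right ab) im fP).
Qed.

Context {U : R -> 'cV[R]_d} {p : 'cV[{poly R}]_d}
  (Up : forall x, a < x < b -> U x = horner_cv p x).

Lemma left_lim_poly i : left_lim (derive1n i U) b = horner_cv (derivcv i p) b.
Proof.
apply: (@left_lim_jet i) => // j.
apply: (jet_eq_on (one_sided_left ab) _ (jet_poly (one_sided_left ab) _ _)) => x xab.
by rewrite Up// mxE.
Qed.

Lemma right_lim_poly i : right_lim (derive1n i U) a = horner_cv (derivcv i p) a.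
Proof.
apply: (@right_lim_jet i) => // j.
apply: (jet_eq_on (one_sided_right ab) _ (jet_poly (one_sided_right ab) _ _)) => x xab.
by rewrite Up// mxE.
Qed.

Lemma derive1_poly x : a < x < b -> derive1 U x = horner_cv (derivcv 1 p) x.
Proof.
move=> xab; apply/colP => j.
have Uj k' : jet a b b b^'- 1 (fun y => U y k' ord0) (p k' ord0).
  apply: (jet_eq_on (one_sided_left ab) _ (jet_poly (one_sided_left ab) _ _)) => y yab.
  by rewrite Up// mxE.
rewrite -[derive1 U]/(derive1n 1 U).
rewrite (derive1n_coord (one_sided_left ab) j (leqnn 1) xab Uj).
rewrite /= derive1E !mxE ?derivn1.
have : is_derive x 1 (fun y => U y j ord0) (p j ord0)^`().[x].
  apply: near_eq_is_derive (is_derive_poly (p j ord0) x).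
  by apply: filterS (near_itv xab) => y yab; rewrite Up// mxE.
by case=> _ ->; rewrite ?mxE.
Qed.

End LimitsOfJets.

(** * Hermite data of the right-hand side *)

Section Interpolants.
Context {R : realType} {d : nat}.

Lemma Cq_on_le (A : set (R * 'cV[R]_d)) m n G : (n <= m)%N ->
  Cq_on A m G -> Cq_on A n G.
Proof.
elim: n m G => [|n IHn] [|m] G //=; first by move=> _ [].
rewrite ltnS => nm [Gc GP]; split=> // v /GP[G' GG' G'C].
by exists G' => //; exact: IHn G'C.
Qed.

Context {k : nat} {a b : R} (ab : a < b) {xs : seq R}.

Lemma interpolates_eq_on f g P : inner_nodes a b xs ->
  (forall x, a < x < b -> f x = g x) ->
  interpolates k a b xs f P -> interpolates k a b xs g P.
Proof.
move=> [_ xsab] fg [fa fb fx]; split.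
- by move=> k0; apply: (jet_eq_on (one_sided_right ab) fg (fa k0)).
- exact: (jet_eq_on (one_sided_left ab) fg fb).
- by move=> x xxs; rewrite fx// fg// xsab.
Qed.

Lemma interpolates_poly P : interpolates k a b xs (horner P) P.
Proof.
by split=> // [_|];
  [exact: (jet_poly (one_sided_right ab))|exact: (jet_poly (one_sided_left ab))].
Qed.

Lemma interpolates_dot (f : R -> 'cV[R]_d) (G phi : 'cV[{poly R}]_d) :
  (forall j, interpolates k a b xs (fun x => f x j ord0) (G j ord0)) ->
  interpolates k a b xs (fun x => dot (f x) (horner_cv phi x)) (dotp G phi).
Proof.
move=> fG.
have dotE : (fun x => dot (f x) (horner_cv phi x)) =
    (fun x => \sum_(j < d) (f x j ord0 * (phi j ord0).[x])).
  by apply/funext => x; apply: eq_bigr => j _; rewrite mxE.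
rewrite dotE; split.
- move=> k0; have Ha := one_sided_right ab.
  apply: (jet_sum Ha) => j; apply: (jetM Ha); last exact: (jet_poly Ha).
  by case: (fG j) => /(_ k0).
- have Hb := one_sided_left ab.
  apply: (jet_sum Hb) => j; apply: (jetM Hb); last exact: (jet_poly Hb).
  by case: (fG j).
- move=> x xxs; rewrite horner_sum; apply: eq_bigr => j _.
  by rewrite hornerM; case: (fG j) => _ _ ->.
Qed.

(** Post-processing does not change the right-hand side as far as the quadrature
    rule is concerned: curves that agree at all quadrature points with
    multiplicity give F the same Hermite data. *)
Lemma common_interpolant (A : set (R * 'cV[R]_d)) F (p q : 'cV[{poly R}]_d) :
  inner_nodes a b xs ->
  (forall (x : R) (y : 'cV[R]_d), a < x < b -> nbhs (x, y) A) ->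
  (forall y, A (a, y)) -> (forall y, A (b, y)) -> Cq_on A k./2 F ->
  (forall j, quad_poly k a b xs %| p j ord0 - q j ord0) ->
  exists G : 'cV[{poly R}]_d, forall j,
    interpolates k a b xs (fun x => F (x, horner_cv p x) j ord0) (G j ord0) /\
    interpolates k a b xs (fun x => F (x, horner_cv q x) j ord0) (G j ord0).
Proof.
move=> xsP Aitv Aa Ab FC pq.
have pq_parts j := (dvdp_quad_poly ab _ _ xsP).1 (pq j).
have pqx x : x \in xs -> horner_cv p x = horner_cv q x.
  move=> xxs; apply/colP => j; rewrite !mxE; have [_ _ /(_ x xxs)] := pq_parts j.
  by rewrite /root hornerD hornerN subr_eq0 => /eqP.
have right_jets j : exists P,
    jet a b b b^'- k./2 (fun x => F (x, horner_cv p x) j ord0) P /\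
    jet a b b b^'- k./2 (fun x => F (x, horner_cv q x) j ord0) P.
  apply: (jet_along_curves (one_sided_left ab) Aitv Ab FC) => i.
  by case: (pq_parts i).
have left_jets j : exists P, (0 < k)%N ->
    jet a b a a^'+ (uphalf k).-1 (fun x => F (x, horner_cv p x) j ord0) P /\
    jet a b a a^'+ (uphalf k).-1 (fun x => F (x, horner_cv q x) j ord0) P.
  have [->|k0] := posnP k; first by exists 0.
  have FC' : Cq_on A (uphalf k).-1 F.
    by apply: Cq_on_le FC; rewrite uphalf_half; case: (odd k); lia.
  have [P PP] : exists P,
      jet a b a a^'+ (uphalf k).-1 (fun x => F (x, horner_cv p x) j ord0) P /\
      jet a b a a^'+ (uphalf k).-1 (fun x => F (x, horner_cv q x) j ord0) P.
    apply: (jet_along_curves (one_sided_right ab) Aitv Aa FC') => i.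
    by rewrite prednK ?uphalf_gt0//; case: (pq_parts i).
  by exists P.
have ex j : exists P, interpolates k a b xs (fun x => F (x, horner_cv p x) j ord0) P /\
    interpolates k a b xs (fun x => F (x, horner_cv q x) j ord0) P.
  have [Pb [pb qb]] := right_jets j; have [Pa PaP] := left_jets j.
  have [P [Pl Pr Px]] :=
    hermite_interpolation ab k (fun x => F (x, horner_cv p x) j ord0) Pa Pb xsP.
  exists P; split; split.
  - move=> k0; have [pa _] := PaP k0; apply: jet_congr pa.
    by rewrite prednK ?uphalf_gt0.
  - exact: jet_congr pb.
  - exact: Px.
  - move=> k0; have [_ qa] := PaP k0; apply: jet_congr qa.
    by rewrite prednK ?uphalf_gt0.
  - exact: jet_congr qb.
  - by move=> x xxs; rewrite Px// pqx.
exists (\col_j sval (cid (ex j))) => j; rewrite mxE.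
exact: (svalP (cid (ex j))).
Qed.

End Interpolants.

(** * Post-processing on one interval *)

(** The one-interval statement for vectors. All one-sided limits and quadratures
    are translated into statements on the polynomials g, gt and G, and the scalar
    argument is applied in each coordinate. *)
Section IntervalStep.
Context {R : realType} {d r k : nat} {nodes : seq R} (kr : (k <= r)%N)
  (nodesP : is_jacobi_nodes r k nodes) {a b : R} (ab : a < b).
Context {M : 'M[R]_d} (M_unit : M \in unitmx) {F : R -> 'cV[R]_d -> 'cV[R]_d}.
Context {A : set (R * 'cV[R]_d)}
  (A_itv : forall (x : R) (y : 'cV[R]_d), a < x < b -> nbhs (x, y) A)
  (A_left : forall y, A (a, y)) (A_right : forall y, A (b, y))
  (F_smooth : Cq_on A k./2 (fun z => F z.1 z.2)).
Context {U Ut : R -> 'cV[R]_d} {p : 'cV[{poly R}]_d} {theta : {poly R}}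
  {alpha jump : 'cV[R]_d}.
Context (size_p : size_le r.+1 p)
  (Up : forall x, a < x < b -> U x = horner_cv p x)
  (size_theta : (size theta <= r.+2)%N)
  (theta_vanishes : vanishes_at_quad_points r k nodes a b theta)
  (theta_norm : theta^`(k./2.+1).[b] = 1)
  (alphaE : alpha = invmx M *m
     (left_lim (derive1n k./2 (fun x => F x (U x))) b
      - M *m left_lim (derive1n k./2.+1 U) b))
  (UtE : forall x, a < x < b -> Ut x = U x + theta.[x] *: alpha).
Context (right_U : forall i, (i < k./2)%N ->
    M *m left_lim (derive1n i.+1 U) b = left_lim (derive1n i (fun x => F x (U x))) b)
  (left_U : forall i, (i < (uphalf k).-1)%N ->
    M *m right_lim (derive1n i.+1 U) a = right_lim (derive1n i (fun x => F x (U x))) a)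
  (var_U : forall phi, size_le (r.+1 - k) phi ->
    quad r k nodes a b (fun x => dot (M *m derive1 U x) (horner_cv phi x))
    + (k == 0%N)%:R * dot (M *m jump) (horner_cv phi a)
    = quad r k nodes a b (fun x => dot (F x (U x)) (horner_cv phi x))).

Local Notation xs := (map (from_ref a b) nodes).
Local Notation W := (quad_poly k a b xs).
Let xsP : inner_nodes a b xs := inner_nodes_from_ref ab (jacobi_inner nodesP).
Local Notation pt := (addcv p theta alpha).

Let W_theta : W %| theta.
Proof. exact: (vanishes_dvdp ab (jacobi_inner nodesP) theta_vanishes). Qed.

Let Utp x : a < x < b -> Ut x = horner_cv pt x.
Proof.
by move=> xab; rewrite UtE// Up// horner_addcv.
Qed.

Let interp_ex : exists G : 'cV[{poly R}]_d, forall j,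
  interpolates k a b xs (fun x => F x (U x) j ord0) (G j ord0) /\
  interpolates k a b xs (fun x => F x (Ut x) j ord0) (G j ord0).
Proof.
have [|G GP] := common_interpolant (p := p) (q := pt)
  ab xsP A_itv A_left A_right F_smooth.
  by move=> j; rewrite mxE opprD addrA subrr sub0r dvdpNr -mul_polyC dvdp_mull.
exists G => j; have [Gp Gq] := GP j; split.
  by apply: (interpolates_eq_on ab xsP _ Gp) => x xab; rewrite Up.
by apply: (interpolates_eq_on ab xsP _ Gq) => x xab; rewrite Utp.
Qed.

(* G carries the Hermite data of F(., U) and of F(., Ut) at the same time. *)
Section WithInterpolant.
Context {G : 'cV[{poly R}]_d}
  (GU : forall j, interpolates k a b xs (fun x => F x (U x) j ord0) (G j ord0))
  (GUt : forall j, interpolates k a b xs (fun x => F x (Ut x) j ord0) (G j ord0)).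

Let g : 'cV[{poly R}]_d := mulcv M (derivcv 1 p).
Let gt : 'cV[{poly R}]_d := mulcv M (derivcv 1 pt).

Lemma size_le_g : size_le r g.
Proof. by apply: size_mulcv; apply: size_derivcv1 size_p. Qed.

Lemma gtE j : gt j ord0 = g j ord0 + (M *m alpha) j ord0 *: theta^`().
Proof.
rewrite !mulcvE mxE scaler_suml -big_split; apply: eq_bigr => i _ /=.
by rewrite !mxE !derivn1 derivD derivZ scalerDr scalerA.
Qed.

Lemma size_le_gt : size_le r.+1 gt.
Proof.
apply: size_mulcv; apply: (@size_derivcv1 _ _ r.+2); apply: size_addcv => // j.
exact: leq_trans (size_p j) _.
Qed.

Lemma left_lim_F V i : (i <= k./2)%N ->
  (forall j, interpolates k a b xs (fun x => F x (V x) j ord0) (G j ord0)) ->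
  left_lim (derive1n i (fun x => F x (V x))) b = horner_cv (derivcv i G) b.
Proof. by move=> ik GV; apply: (left_lim_jet ab ik) => j; case: (GV j). Qed.

Lemma right_lim_F V i : (i < uphalf k)%N ->
  (forall j, interpolates k a b xs (fun x => F x (V x) j ord0) (G j ord0)) ->
  right_lim (derive1n i (fun x => F x (V x))) a = horner_cv (derivcv i G) a.
Proof.
move=> ik GV; have k0 : (0 < k)%N by rewrite -uphalf_gt0; apply: leq_ltn_trans ik.
apply: (right_lim_jet (m := (uphalf k).-1) ab).
  by rewrite -ltnS prednK ?uphalf_gt0.
by move=> j; case: (GV j) => /(_ k0).
Qed.

Lemma mul_horner_derivcv i q x :
  M *m horner_cv (derivcv i.+1 q) x = horner_cv (derivcv i (mulcv M (derivcv 1 q))) x.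
Proof. by rewrite derivcvS derivcv_mulcv horner_mulcv. Qed.

Lemma quad_derive V q phi : (forall x, a < x < b -> V x = horner_cv q x) ->
  (size (dotp (mulcv M (derivcv 1 q)) phi) <= 2 * r - k + 1)%N ->
  quad r k nodes a b (fun x => dot (M *m derive1 V x) (horner_cv phi x)) =
  poly_int a b (dotp (mulcv M (derivcv 1 q)) phi).
Proof.
move=> Vq sz; apply: (quad_exact kr nodesP ab _ sz).
apply: (interpolates_eq_on ab xsP _ (interpolates_poly ab _)) => x xab.
by rewrite horner_dotp horner_mulcv (derive1_poly ab Vq).
Qed.

Lemma quad_F V (phi : 'cV[{poly R}]_d) (q : {poly R}) :
  (forall j, interpolates k a b xs (fun x => F x (V x) j ord0) (G j ord0)) ->
  (size q <= r.+1)%N -> W %| q - dotp G phi ->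
  quad r k nodes a b (fun x => dot (F x (V x)) (horner_cv phi x)) = poly_int a b q.
Proof.
move=> GV sq qG; apply: (quad_interpolates kr nodesP ab _ sq qG).
exact: interpolates_dot.
Qed.

Section Coordinate.
Context (j : 'I_d).

Let right_g : ('X - b%:P) ^+ k./2 %| g j ord0 - G j ord0.
Proof.
apply/dvdp_XsubC_expP => i ik; rewrite derivnB hornerD hornerN.
have := right_U ik; rewrite (left_lim_poly ab Up) (left_lim_F (ltnW ik) GU).
rewrite mul_horner_derivcv => /colP/(_ j); rewrite !mxE => ->.
by rewrite subrr.
Qed.

Let left_g : ('X - a%:P) ^+ (uphalf k).-1 %| g j ord0 - G j ord0.
Proof.
apply/dvdp_XsubC_expP => i ik; rewrite derivnB hornerD hornerN.
have := left_U ik; rewrite (right_lim_poly ab Up) right_lim_F//; last first.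
  by rewrite (leq_trans ik)// leq_pred.
rewrite mul_horner_derivcv => /colP/(_ j); rewrite !mxE => ->.
by rewrite subrr.
Qed.

Let alpha_g : (M *m alpha) j ord0 = - ((g j ord0 - G j ord0)^`(k./2)).[b].
Proof.
rewrite alphaE mulKVmx// (left_lim_F (leqnn _) GU) (left_lim_poly ab Up).
rewrite mul_horner_derivcv !mxE derivnB hornerD hornerN opprB.
by [].
Qed.

Let var_g (phi q : {poly R}) : (size phi <= r.+1 - k)%N -> (size q <= r.+1)%N ->
  W %| q - G j ord0 * phi ->
  poly_int a b (g j ord0 * phi) + (k == 0%N)%:R * ((M *m jump) j ord0 * phi.[a])
  = poly_int a b q.
Proof.
move=> sphi sq qG; have sphi' := size_le_coordcv j sphi.
rewrite -(quad_F (phi := coordcv j phi) GU sq); last by rewrite dotp_coordcv.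
rewrite -(var_U sphi') (quad_derive Up) ?dotp_coordcv ?dot_coordcv//.
rewrite (leq_trans (size_polyMleq _ _))//.
by move: (size_le_g j) sphi kr; rewrite /g; lia.
Qed.

Lemma coordinate_step :
  [/\ ('X - b%:P) ^+ k./2.+1 %| gt j ord0 - G j ord0,
      ('X - a%:P) ^+ uphalf k %| gt j ord0 - G j ord0,
      (k == 0%N)%:R * (M *m jump) j ord0 + (M *m alpha) j ord0 * theta.[a] = 0 &
      forall phi q : {poly R}, (size phi <= r.+1 - k)%N -> (size q <= r.+1)%N ->
        W %| q - G j ord0 * phi -> poly_int a b (gt j ord0 * phi) = poly_int a b q].
Proof.
have sg := size_le_g j; rewrite gtE; split.
- exact: (step_right nodesP ab W_theta theta_norm alpha_g right_g).
- exact: (step_left kr nodesP ab size_theta W_theta theta_norm sg alpha_g right_g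
    left_g var_g).
- exact: (step_jump kr nodesP ab size_theta W_theta theta_norm sg alpha_g right_g
    left_g var_g).
- exact: (step_var kr nodesP ab size_theta W_theta theta_norm sg alpha_g right_g
    left_g var_g).
Qed.

End Coordinate.

Lemma step_jump_vec : (k == 0%N)%:R *: jump + theta.[a] *: alpha = 0.
Proof.
apply: (can_inj (mulKmx M_unit)); rewrite mulmx0 mulmxDr -!scalemxAr.
by apply/colP => j; have [_ _ + _] := coordinate_step j; rewrite !mxE (mulrC theta.[a]).
Qed.

Lemma step_right_end i : (i <= k./2)%N ->
  M *m left_lim (derive1n i.+1 Ut) b = left_lim (derive1n i (fun x => F x (Ut x))) b.
Proof.
move=> ik; rewrite (left_lim_poly ab Utp) (left_lim_F ik GUt) mul_horner_derivcv.
apply/colP => j; rewrite !horner_derivcvE; apply/eqP.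
rewrite -subr_eq0 -hornerN -hornerD -derivnB.
have [dvd _ _ _] := coordinate_step j.
by rewrite ((dvdp_XsubC_expP _ _ _).2 dvd).
Qed.

Lemma step_left_end i : (i < uphalf k)%N ->
  M *m right_lim (derive1n i.+1 Ut) a = right_lim (derive1n i (fun x => F x (Ut x))) a.
Proof.
move=> ik; rewrite (right_lim_poly ab Utp) (right_lim_F ik GUt) mul_horner_derivcv.
apply/colP => j; rewrite !horner_derivcvE; apply/eqP.
rewrite -subr_eq0 -hornerN -hornerD -derivnB.
have [_ dvd _ _] := coordinate_step j.
by rewrite ((dvdp_XsubC_expP _ _ _).2 dvd).
Qed.

Lemma step_variational phi : size_le (r.+1 - k) phi ->
  quad r k nodes a b (fun x => dot (M *m derive1 Ut x) (horner_cv phi x)) =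
  quad r k nodes a b (fun x => dot (F x (Ut x)) (horner_cv phi x)).
Proof.
move=> sphi; rewrite (quad_derive Utp); last first.
  by rewrite (leq_trans (size_dotp size_le_gt sphi))//; move: kr; lia.
(* The interpolant of dot F phi, assembled coordinatewise. *)
have Wcongr j : W %| (G j ord0 * phi j ord0) %% W - G j ord0 * phi j ord0.
  exact: modp_congr.
pose q := \sum_(j < d) (G j ord0 * phi j ord0) %% W.
have sq (u : {poly R}) := size_modp_quad_poly kr nodesP (a := a) (b := b) u.
rewrite (quad_F (q := q) GUt).
- rewrite /q /dotp; move: (index_enum _) => s.
  elim: s => [|j s IHs]; first by rewrite !big_nil.
  rewrite !big_cons !poly_intD// IHs; congr (_ + _).
  by have [_ _ _ var] := coordinate_step j; apply: var.
- by rewrite (leq_trans (size_sum _ _ _))//; apply/bigmax_leqP.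
- rewrite /q /dotp -sumrB; apply: (big_ind (dvdp W)) => [|u v|j _];
    [exact: dvdp0|exact: dvdp_add|exact: Wcongr].
Qed.

End WithInterpolant.

Lemma interval_step :
  [/\ (k == 0%N)%:R *: jump + theta.[a] *: alpha = 0,
      forall i, (i <= k./2)%N -> M *m left_lim (derive1n i.+1 Ut) b
        = left_lim (derive1n i (fun x => F x (Ut x))) b,
      forall i, (i < uphalf k)%N -> M *m right_lim (derive1n i.+1 Ut) a
        = right_lim (derive1n i (fun x => F x (Ut x))) a &
      forall phi, size_le (r.+1 - k) phi ->
        quad r k nodes a b (fun x => dot (M *m derive1 Ut x) (horner_cv phi x)) =
        quad r k nodes a b (fun x => dot (F x (Ut x)) (horner_cv phi x))].
Proof.
have [G GP] := interp_ex.
have GU j : interpolates k a b xs (fun x => F x (U x) j ord0) (G j ord0).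
  by case: (GP j).
have GUt j : interpolates k a b xs (fun x => F x (Ut x) j ord0) (G j ord0).
  by case: (GP j).
split.
- exact: step_jump_vec GU.
- exact: step_right_end GU GUt.
- exact: step_left_end GU GUt.
- exact: step_variational GU GUt.
Qed.

End IntervalStep.

(** * Post-processing on the whole mesh *)

Section Mesh.
Context {R : realType} {t0 T : R} {N : nat} {t : nat -> R} (ht : mesh t0 T N t).

Lemma mesh_lt n : (n < N)%N -> t n < t n.+1.
Proof. by case: ht => _ _; apply. Qed.

Lemma mesh_le m n : (m <= n)%N -> (n <= N)%N -> t m <= t n.
Proof.
elim: n => [|n IHn]; first by rewrite leqn0 => /eqP ->.
rewrite leq_eqVlt => /predU1P[-> //|mn] nN.
by rewrite (le_trans (IHn mn (ltnW nN)))// ltW// mesh_lt.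
Qed.

Lemma mesh_ge_start n : (n <= N)%N -> t0 <= t n.
Proof. by case: (ht) => <- _ _ nN; exact: mesh_le. Qed.

Lemma mesh_le_end n : (n <= N)%N -> t n <= t0 + T.
Proof. by case: (ht) => _ <- _ nN; exact: mesh_le. Qed.

Lemma nbhs_strip {d} n (x : R) (y : 'cV[R]_d) : (n < N)%N -> t n < x < t n.+1 ->
  nbhs (x, y) ([set` `[t0, t0 + T]] `*` [set: 'cV[R]_d]).
Proof.
move=> nN xn; exists ([set` `[t0, t0 + T]], setT) => //=; split; last exact: filterT.
apply: filterS (near_itv xn) => z /andP[nz zn]; rewrite /= in_itv/=.
by rewrite (le_trans (mesh_ge_start (ltnW nN)) (ltW nz))
  (le_trans (ltW zn) (mesh_le_end nN)).
Qed.

End Mesh.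

Theorem theorem3p1 (R : realType) (d : nat) (t0 T : R) (hT : 0 < T)
  (M : 'M[R]_d) (hM : M \in unitmx)
  (F : R -> 'cV[R]_d -> 'cV[R]_d) (u0 : 'cV[R]_d)
  (N : nat) (t : nat -> R) (ht : mesh t0 T N t)
  (r k : nat) (hkr : (k <= r)%N)
  (hFsmooth : Cq_on ([set` `[t0, t0 + T]] `*` setT) k./2
                (fun z => F z.1 z.2))
  (hFlip : exists L : R, forall x, t0 <= x <= t0 + T -> L.-lipschitz (F x))
  (nodes : seq R) (hnodes : is_jacobi_nodes r k nodes)
  (U : R -> 'cV[R]_d)
  (hU : solves_VTD M F u0 N t (quad r k nodes) r k U)
  (theta : nat -> {poly R})
  (htheta : forall n, (n < N)%N ->
     [/\ (size (theta n) <= r.+2)%N,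
         vanishes_at_quad_points r k nodes (t n) (t n.+1) (theta n) &
         (derivn k./2.+1 (theta n)).[t n.+1] = 1])
  (a : nat -> 'cV[R]_d)
  (ha : forall n, (n < N)%N ->
     a n = invmx M *m
       (left_lim (derive1n k./2 (fun x => F x (U x))) (t n.+1)
        - M *m left_lim (derive1n k./2.+1 U) (t n.+1)))
  (Ut : R -> 'cV[R]_d)
  (hUt : forall n, (n < N)%N -> forall x, t n < x <= t n.+1 ->
     Ut x = U x + (theta n).[x] *: a n)
  (hUt0 : Ut x @[x --> (t 0%N)^'-] --> left_lim U (t 0%N)) :
  in_Y N t r.+1 Ut /\
  solves_VTD M F u0 N t (quad r k nodes) r.+1 k.+2 Ut.
Proof.
have [_ U_space U_init U_cont U_right U_left U_var] := hU.
have t_lt n (nN : (n < N)%N) : t n < t n.+1 := mesh_lt ht nN.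
have hUt' n p : (n < N)%N -> (forall x, t n < x <= t n.+1 -> U x = horner_cv p x) ->
    forall x, t n < x < t n.+1 -> U x = horner_cv p x.
  by move=> nN Up x /andP[nx xn]; apply: Up; rewrite nx ltW.
have UtE n : (n < N)%N ->
    forall x, t n < x < t n.+1 -> Ut x = U x + (theta n).[x] *: a n.
  by move=> nN x /andP[nx xn]; apply: hUt => //; rewrite nx ltW.
have Ut_space : in_Y N t r.+1 Ut.
  move=> n nN; have [p sp Up] := U_space n nN; exists (addcv p (theta n) (a n)).
    apply: size_addcv => [j|]; first exact: leq_trans (sp j) _.
    by case: (htheta n nN).
  by move=> x xn; rewrite (hUt n)// Up// horner_addcv.
have step n (nN : (n < N)%N) :
    [/\ (k == 0%N)%:R *: (right_lim U (t n) - left_lim U (t n))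
        + (theta n).[t n] *: a n = 0,
      forall i, (i <= k./2)%N -> M *m left_lim (derive1n i.+1 Ut) (t n.+1)
        = left_lim (derive1n i (fun x => F x (Ut x))) (t n.+1),
      forall i, (i < uphalf k)%N -> M *m right_lim (derive1n i.+1 Ut) (t n)
        = right_lim (derive1n i (fun x => F x (Ut x))) (t n) &
      forall phi, size_le (r.+1 - k) phi ->
        quad r k nodes (t n) (t n.+1)
          (fun x => dot (M *m derive1 Ut x) (horner_cv phi x)) =
        quad r k nodes (t n) (t n.+1)
          (fun x => dot (F x (Ut x)) (horner_cv phi x))].
  have [p sp Up] := U_space n nN; have [st tv tn] := htheta n nN.
  apply: (interval_step hkr hnodes (t_lt n nN) hM _ _ _ hFsmooth sp (hUt' n p nN Up)
    st tv tn (ha n nN) (UtE n nN)).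
  - by move=> x y xn; exact: (nbhs_strip ht y nN xn).
  - by move=> y; split=> //=; rewrite in_itv/= (mesh_ge_start ht)
      ?(mesh_le_end ht) ?(ltnW nN).
  - by move=> y; split=> //=; rewrite in_itv/= (mesh_ge_start ht)
      ?(mesh_le_end ht).
  - by move=> i ik; apply: U_right => //; case: (k) ik => [|[]].
  - move=> i ik; apply: U_left => //; first by case: (k) ik => [|[|[]]].
    by case: (k) ik.
  - exact: U_var.
have right_limU n p : (n < N)%N ->
    (forall x, t n < x <= t n.+1 -> U x = horner_cv p x) ->
    right_lim U (t n) = horner_cv p (t n).
  move=> nN Up; have := right_lim_poly (t_lt n nN) (hUt' n p nN Up) 0.
  by rewrite derivcv0.
have right_limUt n : (n < N)%N ->
    right_lim Ut (t n) = right_lim U (t n) + (theta n).[t n] *: a n.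
  move=> nN; have [p sp Up] := U_space n nN.
  rewrite (right_limU n p nN Up) -horner_addcv.
  have Utp x : t n < x < t n.+1 -> Ut x = horner_cv (addcv p (theta n) (a n)) x.
    by move=> xn; rewrite (UtE n)// (hUt' n p nN Up)// horner_addcv.
  by have := right_lim_poly (t_lt n nN) Utp 0; rewrite derivcv0.
(* From the left, t n is the right end of the previous interval, where theta
   vanishes; for n = 0 the value is prescribed. *)
have left_limUt n : (n < N)%N -> left_lim Ut (t n) = left_lim U (t n).
  case: n => [_|n /ltnW nN]; first exact: norm_cvg_lim.
  have [p sp Up] := U_space n nN.
  have Utp x : t n < x < t n.+1 -> Ut x = horner_cv (addcv p (theta n) (a n)) x.
    by move=> xn; rewrite (UtE n)// (hUt' n p nN Up)// horner_addcv.
  have := left_lim_poly (t_lt n nN) Utp 0.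
  have := left_lim_poly (t_lt n nN) (hUt' n p nN Up) 0.
  have [_ tv _] := htheta n nN.
  have W_theta := vanishes_dvdp (t_lt n nN) (jacobi_inner hnodes) tv.
  rewrite !derivcv0 /= => -> ->; rewrite horner_addcv.
  by rewrite (theta_root_right hnodes (t_lt n nN) W_theta) scale0r addr0.
split=> //; split=> //.
- have -> : u0 = left_lim U (t 0%N) by apply/esym; exact: norm_cvg_lim U_init.
  exact: hUt0.
- move=> n nN _; rewrite right_limUt// left_limUt//.
  (* For k = 0 the correction closes the jump of U; otherwise there is none. *)
  have [jump _ _ _] := step n nN.
  have [k0|k0] := posnP k.
    move: jump; rewrite k0 eqxx scale1r addrAC => /eqP; rewrite subr_eq0 => /eqP.
    by [].
  move: jump; rewrite (gtn_eqF k0) scale0r add0r => ->; rewrite addr0.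
  exact: U_cont.
- by move=> n i nN _ ik; have [_ rgt _ _] := step n nN; apply: rgt.
- move=> n i nN _ ik; have [_ _ lft _] := step n nN; apply: lft.
  by rewrite uphalfE.
- move=> n nN phi sphi; have [_ _ _ var] := step n nN.
  rewrite mul0r addr0; apply: var => i; apply: leq_trans (sphi i) _.
  by lia.
Qed.
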